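(* Let $n\geqq 2$ and $h>0$. For $u\in\mathscr{E}'(\mathbb{R}^n)$, if $n$ is odd then $\mathcal{T}_hu=\mathcal{B}_h\mathcal{R}u$, and if $n$ is even then $\mathcal{T}_hu=\mathcal{B}_h\mathcal{H}\mathcal{R}u$, where $\mathcal{H}$ is the Hilbert transform in $t\in\mathbb{R}$ defined by $$\mathcal{H}U(\omega,t):=\operatorname{PV}\int_{-\infty}^\infty\frac{U(\omega,s)}{t-s}\,ds=\lim_{\varepsilon\downarrow0}\int_{|t-s|>\varepsilon}\frac{U(\omega,s)}{t-s}\,ds .$$ Note that if $U(-\omega,-t)=U(\omega,t)$, then $\mathcal{H}U(-\omega,-t)=-\mathcal{H}U(\omega,t)$.
   Context: For $z,\zeta\in\mathbb{C}^n$ write $z\zeta:=z_1\zeta_1+\dots+z_n\zeta_n$ (bilinear, no conjugation) and $z^2:=zz$. $h>0$ is the semiclassical parameter. $\mathscr{E}'$ denotes compactly supported distributions. Bargmann transform on $\mathbb{R}^n$: for a tempered distribution $u$ on $\mathbb{R}^n$, $$\mathcal{T}_hu(z):=2^{n/4}h^{-3n/4}\int_{\mathbb{R}^n}e^{-\pi(z-y)^2/h}u(y)\,dy,\quad z\in\mathbb{C}^n.$$ Space of hyperplanes: $\mathbb{P}^n$ is the set of all hyperplanes $\{x\in\mathbb{R}^n: x\omega=t\}$, $(\omega,t)\in\mathbb{S}^{n-1}\times\mathbb{R}$, that is, the quotient of $\mathbb{S}^{n-1}\times\mathbb{R}$ in which $(\omega,t)$ and $(-\omega,-t)$ are identified.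 A function on $\mathbb{P}^n$ is a function $U$ on $\mathbb{S}^{n-1}\times\mathbb{R}$ with $U(-\omega,-t)=U(\omega,t)$; a function on $\widetilde{\mathbb{P}^n}$ is one with $U(-\omega,-t)=(-1)^{n-1}U(\omega,t)$. $\mathscr{S}(\mathbb{S}^{n-1}\times\mathbb{R})$ is the space of smooth functions $U$ such that $\sup|t^lP\,\partial_t^kU|<\infty$ for all $k,l=0,1,2,\dots$ and all differential operators $P$ on $\mathbb{S}^{n-1}$ with smooth coefficients, and $\mathscr{S}'(\mathbb{S}^{n-1}\times\mathbb{R})$ is its topological dual; $\mathscr{S}(\mathbb{P}^n)$, $\mathscr{S}'(\mathbb{P}^n)$ and $\mathscr{S}(\widetilde{\mathbb{P}^n})$, $\mathscr{S}'(\widetilde{\mathbb{P}^n})$ are defined similarly. $d\omega$ is the standard Lebesgue measure on $\mathbb{S}^{n-1}$. Radon transform: $\mathcal{R}f(\omega,t):=\int_{\omega^\perp}f(t\omega+y)\,dm(y)$, where $m$ is the Lebesgue measure on hyperplanes induced by the Euclidean metric, for locally integrable $f$ with $f(x)=\mathcal{O}(|x|^{-(n-1)-\delta})$ as $|x|\to\infty$ for some $\delta>0$. It is a function on $\mathbb{P}^n$. It is extended to $u\in\mathscr{E}'(\mathbb{R}^n)$ in the usual way (by duality with the dual Radon transform $\mathcal{R}^*U(x)=\int_{\mathbb{S}^{n-1}}U(\omega,x\omega)\,d\omega$, as in Helgason's textbook on the Radon transform), and then $\mathcal{R}u\in\mathscr{E}'(\mathbb{P}^n)$. Transform $\mathcal{B}_h$: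 for $U\in\mathscr{S}'(\widetilde{\mathbb{P}^n})$, $$\mathcal{B}_hU(z):=A_nh^{-3n/4}\iint_{\mathbb{P}^n}e^{-\pi(z\omega-t)^2/h}H_{n-1}\!\left(\sqrt{\frac{\pi}{h}}(z\omega-t)\right)U(\omega,t)\,d\omega\,dt,\quad z\in\mathbb{C}^n,$$ where $A_n$ is the constant defined by $$A_{2k+1}=\frac{(-1)^kk!}{2^{k/2-1/4}(2k)!},\qquad A_{2k}=\frac{(-1)^{k-1/2}\pi^{1/2}}{2^{3k/2}(k-1)!},\qquad k=1,2,3,\dots,$$ and $H_l$ is the Hermite polynomial $$H_l(s)=(-1)^le^{s^2}\frac{d^l}{ds^l}e^{-s^2}=l!\sum_{j=0}^{[l/2]}\frac{(-1)^j}{j!(l-2j)!}(2s)^{l-2j},\quad l=1,2,3,\dots,$$ with $[\cdot]$ the floor function. The integrals of distributions are understood as pairings.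
   Formalization: The printed A_n fails already for u the Dirac mass at 0 and is corrected to A_{2k+1}=(-1)^k/(2^{3k/2+3/4}π^k), A_{2k}=(-1)^k/(2^{3k/2}π^{k+1/2}), with dω the surface measure and the integral over P^n taken over all of S^{n-1}×R. *)

(* Defs.v *)
(* MathComp-Analysis world: the reals are an arbitrary R : realType and the
   complex numbers are R[i].  R[i] carries no analysis over R in the library,
   so derivatives, integrals and limits of complex-valued functions are taken
   on the real and imaginary parts. *)
From HB Require Import structures.
From mathcomp Require Export all_boot all_order all_algebra.
From mathcomp Require Export complex.
From mathcomp Require Export all_classical all_reals all_analysis.

Set Implicit Arguments.
Unset Strict Implicit.
Unset Printing Implicit Defensive.

Export Order.TTheory GRing.Theory Num.Theory.
Export numFieldNormedType.Exports.

Local Open Scope classical_set_scope.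
Local Open Scope ring_scope.
Local Open Scope complex_scope.

Local Notation Re := complex.Re.
Local Notation Im := complex.Im.

Section Complex.
Variable R : realType.

Definition cexp (z : R[i]) : R[i] :=
  (expR (Re z) * cos (Im z)) +i* (expR (Re z) * sin (Im z)).

Definition cintegral (D : set R) (f : R -> R[i]) : R[i] :=
  (\int[lebesgue_measure]_(x in D) Re (f x)) +i*
  (\int[lebesgue_measure]_(x in D) Im (f x)).

Definition cintegrable (D : set R) (f : R -> R[i]) : Prop :=
  lebesgue_measure.-integrable D (fun x => (Re (f x))%:E) /\
  lebesgue_measure.-integrable D (fun x => (Im (f x))%:E).

(* The bilinear (not Hermitian) product. *)
Definition dot (K : comNzRingType) n (x y : 'rV[K]_n) : K :=
  \sum_(i < n) x 0 i * y 0 i.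

Definition toC n (x : 'rV[R]_n) : 'rV[R[i]]_n := map_mx (real_complex R) x.

End Complex.

Section CompactlySupportedDistributions.
Variables (R : realType) (n : nat).

Definition partial (i : 'I_n) (f : 'rV[R]_n -> R[i]) : 'rV[R]_n -> R[i] :=
  fun x => ('D_(delta_mx 0 i) (fun y => Re (f y)) x : R) +i*
           ('D_(delta_mx 0 i) (fun y => Im (f y)) x : R).

(* Iterated partial derivative along a sequence s of directions; its order is
   the size of s. *)
Definition partials (s : seq 'I_n) (f : 'rV[R]_n -> R[i]) : 'rV[R]_n -> R[i] :=
  foldr partial f s.

Definition smooth (f : 'rV[R]_n -> R[i]) : Prop :=
  forall (s : seq 'I_n) (x : 'rV[R]_n),
    differentiable (fun y => Re (partials s f y) : R) x /\
    differentiable (fun y => Im (partials s f y) : R) x.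

(* u is a compactly supported distribution on R^n, i.e. a continuous linear
   functional on C^oo(R^n).  As a Rocq function u takes arbitrary arguments;
   its values off the smooth functions are unconstrained and carry no
   meaning. *)
Definition compact_distribution (u : ('rV[R]_n -> R[i]) -> R[i]) : Prop :=
  (forall (a : R[i]) (f g : 'rV[R]_n -> R[i]), smooth f -> smooth g ->
     u (fun x => a * f x + g x) = a * u f + u g) /\
  (exists K : set 'rV[R]_n, exists N : nat, exists C : R,
     compact K /\
     forall (f : 'rV[R]_n -> R[i]) (M : R), smooth f -> 0 <= M ->
       (forall (s : seq 'I_n) (x : 'rV[R]_n), (size s <= N)%N -> K x ->
          `|partials s f x| <= M%:C) ->
       `|u f| <= (C * M)%:C).

End CompactlySupportedDistributions.

Section Sphere.
Variable R : realType.

(* Integral over the unit sphere S^d of 'rV_d.+1 against its surface measure,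
   in the spherical coordinates w = (cos t, sin t * v), v in S^(d-1),
   dw = sin(t)^(d-1) dt dv; the measure on S^0 = {1, -1} is counting. *)
Fixpoint sphere_integral_rec (d : nat) : ('rV[R]_d.+1 -> R[i]) -> R[i] :=
  match d return ('rV[R]_d.+1 -> R[i]) -> R[i] with
  | 0 => fun g => g 1%:M + g (- 1%:M)
  | e.+1 => fun g =>
      cintegral [set` `[0%R, (pi : R)]] (fun t =>
        (sin t ^+ e)%:C *
        sphere_integral_rec (fun v : 'rV[R]_e.+1 =>
          g (row_mx ((cos t)%:M : 'rV[R]_1) (sin t *: v))))
  end.

(* The integral over S^(n-1) in R^n. *)
Definition sphere_integral (n : nat) : ('rV[R]_n -> R[i]) -> R[i] :=
  match n return ('rV[R]_n -> R[i]) -> R[i] with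
  | 0 => fun _ => 0
  | d.+1 => @sphere_integral_rec d
  end.

End Sphere.

(* A function on S^(n-1) x R is a function of (w, t) : 'rV_n * R, of which only
   the values at unit vectors w matter.  The integral over the space of
   hyperplanes is normalized as the integral over all of S^(n-1) x R, so that
   each hyperplane is counted twice; with this normalization the transpose of
   the Radon transform is exactly dual_radon.  A distribution on the space of
   hyperplanes is a functional on functions on S^(n-1) x R. *)
Section Hyperplanes.
Variables (R : realType) (n : nat).

Definition dual_radon (F : 'rV[R]_n -> R -> R[i]) : 'rV[R]_n -> R[i] :=
  fun x => sphere_integral (fun w => F w (dot x w)).

Definition radon (u : ('rV[R]_n -> R[i]) -> R[i]) :
    ('rV[R]_n -> R -> R[i]) -> R[i] :=
  fun F => u (dual_radon F).

Definition hilbert_trunc (F : 'rV[R]_n -> R -> R[i]) (w : 'rV[R]_n) (t e : R)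
    : R[i] :=
  cintegral [set s | e < `|t - s|] (fun s => F w s / (t - s)%:C).

Definition hilbert (F : 'rV[R]_n -> R -> R[i]) (w : 'rV[R]_n) (t : R) : R[i] :=
  (lim (Re (hilbert_trunc F w t e) @[e --> (0 : R)^'+]) : R) +i*
  (lim (Im (hilbert_trunc F w t e) @[e --> (0 : R)^'+]) : R).

(* The principal value defining [hilbert F w t] exists. *)
Definition hilbert_exists (F : 'rV[R]_n -> R -> R[i]) (w : 'rV[R]_n) (t : R)
    : Prop :=
  [/\ forall e : R, 0 < e ->
        cintegrable [set s | e < `|t - s|] (fun s => F w s / (t - s)%:C),
      cvg (Re (hilbert_trunc F w t e) @[e --> (0 : R)^'+]) &
      cvg (Im (hilbert_trunc F w t e) @[e --> (0 : R)^'+])].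

(* Extension of the Hilbert transform to compactly supported distributions by
   transposition; the sign appears because 1/t is odd. *)
Definition hilbert_distribution (U : ('rV[R]_n -> R -> R[i]) -> R[i]) :
    ('rV[R]_n -> R -> R[i]) -> R[i] :=
  fun F => U (fun w t => - hilbert F w t).

End Hyperplanes.

Section Transforms.
Variable R : realType.

Definition hermite (l : nat) (s : R[i]) : R[i] :=
  (l`!)%:R * \sum_(j < l./2.+1)
    (-1) ^+ j / ((j`!)%:R * ((l - j.*2)`!)%:R) * (2 * s) ^+ (l - j.*2).

(* The constant A_n, for the normalizations of this file: the non-normalized
   surface measure of the sphere, the integral over all of S^(n-1) x R, and the
   Hilbert transform with kernel 1/t.  With n = 2k+1 or n = 2k,
     A_(2k+1) = (-1)^k / (2^(3k/2+3/4) pi^k),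
     A_(2k)   = (-1)^k / (2^(3k/2) pi^(k+1/2)).
   The literature also gives
     (-1)^k k! / (2^(k/2-1/4) (2k)!),
     (-1)^(k-1/2) pi^(1/2) / (2^(3k/2) (k-1)!),
   for which the Radon factorization of the Bargmann transform fails already on
   the Dirac mass at 0, evaluated at z = 0, where it would read |S^(2k)| = 2^k
   for odd n and would equate a positive number with an imaginary one for
   even n. *)
Definition A_const (n : nat) : R :=
  let k := n./2 in
  if odd n then
    (-1) ^+ k / (2 `^ (3 * k%:R / 2 + 3 / 4) * pi ^+ k)
  else
    (-1) ^+ k / (2 `^ (3 * k%:R / 2) * pi `^ (k%:R + 1 / 2)).

Definition bargmann n (h : R) (u : ('rV[R]_n -> R[i]) -> R[i])
    (z : 'rV[R[i]]_n) : R[i] :=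
  (2 `^ (n%:R / 4) * h `^ (- (3 * n%:R / 4)))%:C *
  u (fun y => cexp (- (pi / h)%:C * dot (z - toC y) (z - toC y))).

Definition B_kernel n (h : R) (z : 'rV[R[i]]_n) (w : 'rV[R]_n) (t : R) : R[i] :=
  let s := dot z (toC w) - t%:C in
  cexp (- (pi / h)%:C * s ^+ 2) * hermite n.-1 ((Num.sqrt (pi / h))%:C * s).

Definition B_transform n (h : R) (U : ('rV[R]_n -> R -> R[i]) -> R[i])
    (z : 'rV[R[i]]_n) : R[i] :=
  (A_const n * h `^ (- (3 * n%:R / 4)))%:C * U (B_kernel h z).

End Transforms.

(* Main.v *)
Require Import Defs.
From mathcomp Require Import measurable_realfun.
From mathcomp Require Import ring lra zify.

(** Both transforms pair [u] with a smooth function of [y], so the theorem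
    reduces to an identity between functions.  Put
    [zeta = sqrt (pi / h) (z - y)] and let [G_l (c) = exp (- c ^ 2) H_l (c)] be
    the Hermite functions.  The identity to prove is

      A_n * (integral over the sphere of F (zeta w) dw)
        = 2 ^ (n / 4) * exp (- zeta zeta),

    where [F] is [G_(n-1)] if [n] is odd, and the transposed Hilbert transform
    [F (c) = - PV (integral of G_(n-1) (c + x) / x dx)] if [n] is even.

    It is proved by comparing Taylor coefficients at [zeta = 0].  Since
    [G_l' = - G_(l+1)], the expansion of [G_l] has coefficients
    [(-1) ^ m / m! * G_(l+m) (0)], and that of the principal value has
    coefficients [(-1) ^ m / m! * PV (integral of G_(l+m) (x) / x dx)].  Write
    [f_m] for these values of index [l + m], where [l = n - 1].  The recurrence
    [G_(l+2) = 2 x G_(l+1) - 2 (l + 1) G_l] gives in both cases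
    [f_(m+2) = - 2 (n + m) f_m]: at the origin the middle term vanishes,
    and under the principal value it becomes the integral of a derivative
    ([hermite_momentSS]).  On the other side the moments of linear forms are
    [int (zeta w) ^ (2 p) dw = sigma_p (zeta zeta) ^ p] with
    [sigma_(p+1) = sigma_p (2 p + 1) / (n + 2 p)] ([sphere_power],
    [sphere_coef_rec]).  The factors [n + 2 p] cancel and the exponential series
    of [- zeta zeta] remains ([sphere_mean]).  The constant is checked by going
    from [n] to [n + 2] ([normalization]).

    Term by term integration rests on one estimate, [taylor_rem_decay]: the
    Taylor remainder of [G_l] at a real point [x] is geometrically small,
    uniformly for [c] in a disc and with the weight [exp (- |x|)].  It makes
    the principal values converge ([hermite_hilbert_series]) and, with the
    continuity of the sphere integral under uniform convergence
    ([sphere_uniform_limit], [sphere_le]), the spherical means as well.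

    The parity of the Hilbert transform is the change of variable [s -> - s] in
    the truncated integrals, valid for every integrable function because the
    Lebesgue measure is invariant under reflection ([hilbert_reflected]). *)

Set Implicit Arguments.
Unset Strict Implicit.
Unset Printing Implicit Defensive.

Local Open Scope classical_set_scope.
Local Open Scope ring_scope.
Local Open Scope complex_scope.

Local Notation Re := complex.Re.
Local Notation Im := complex.Im.

(** * Complex numbers through real and imaginary parts *)

Section ComplexArithmetic.
Variable R : realType.
Implicit Types z w : R[i].

Lemma ReD z w : Re (z + w) = Re z + Re w. Proof. by case: z; case: w. Qed.
Lemma ImD z w : Im (z + w) = Im z + Im w. Proof. by case: z; case: w. Qed.
Lemma ReN z : Re (- z) = - Re z. Proof. by case: z. Qed.
Lemma ImN z : Im (- z) = - Im z. Proof. by case: z. Qed.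
Lemma ReB z w : Re (z - w) = Re z - Re w. Proof. by rewrite ReD ReN. Qed.
Lemma ImB z w : Im (z - w) = Im z - Im w. Proof. by rewrite ImD ImN. Qed.
Lemma ReM z w : Re (z * w) = Re z * Re w - Im z * Im w.
Proof. by case: z; case: w. Qed.
Lemma ImM z w : Im (z * w) = Re z * Im w + Im z * Re w.
Proof.
by case: z => a b; case: w => c d /=;
  rewrite addrC [b * c]mulrC addrC [c * b]mulrC.
Qed.
Lemma ReZ (a : R) z : Re (a%:C * z) = a * Re z.
Proof. by rewrite ReM /= mul0r subr0. Qed.
Lemma ImZ (a : R) z : Im (a%:C * z) = a * Im z.
Proof. by rewrite ImM /= mul0r addr0. Qed.
Lemma complexP z w : Re z = Re w -> Im z = Im w -> z = w.
Proof. by case: z => a b; case: w => c d /= -> ->. Qed.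

(** The l1 norm of the plane: it dominates both parts of a complex number and
    is submultiplicative, which is all that the estimates below require. *)
Definition norm1 z : R := `|Re z| + `|Im z|.

Lemma norm1_ge0 z : 0 <= norm1 z. Proof. exact: addr_ge0. Qed.
Lemma Re_le_norm1 z : `|Re z| <= norm1 z. Proof. by rewrite lerDl. Qed.
Lemma Im_le_norm1 z : `|Im z| <= norm1 z. Proof. by rewrite lerDr. Qed.
Lemma norm10 : norm1 0 = 0. Proof. by rewrite /norm1 normr0 addr0. Qed.
Lemma norm1_real (a : R) : norm1 a%:C = `|a|.
Proof. by rewrite /norm1 /= normr0 addr0. Qed.
Lemma norm1_eq0 z : norm1 z <= 0 -> z = 0.
Proof.
move=> z0; apply: complexP => /=; apply/eqP; rewrite -normr_le0.
  exact: le_trans (Re_le_norm1 z) z0.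
exact: le_trans (Im_le_norm1 z) z0.
Qed.
Lemma norm1D z w : norm1 (z + w) <= norm1 z + norm1 w.
Proof. by rewrite /norm1 ReD ImD addrACA lerD// ler_normD. Qed.
Lemma norm1N z : norm1 (- z) = norm1 z.
Proof. by rewrite /norm1 ReN ImN !normrN. Qed.
Lemma norm1M z w : norm1 (z * w) <= norm1 z * norm1 w.
Proof.
rewrite /norm1 ReM ImM mulrDl !mulrDr -!normrM.
apply: le_trans (lerD (ler_normB _ _) (ler_normD _ _)) _.
lra.
Qed.
Lemma norm1Z (a : R) z : norm1 (a%:C * z) = `|a| * norm1 z.
Proof. by rewrite /norm1 ReZ ImZ !normrM mulrDr. Qed.
Lemma norm1X z n : norm1 (z ^+ n) <= norm1 z ^+ n.
Proof.
elim: n => [|n IH]; first by rewrite !expr0 norm1_real normr1.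
rewrite !exprS; apply: le_trans (norm1M _ _) _.
by rewrite ler_wpM2l ?norm1_ge0.
Qed.
Lemma norm1_sum I (r : seq I) (P : pred I) (F : I -> R[i]) :
  norm1 (\sum_(i <- r | P i) F i) <= \sum_(i <- r | P i) norm1 (F i).
Proof.
elim/big_rec2 : _ => [|i x y _ xy]; first by rewrite norm10.
exact: le_trans (norm1D _ _) (lerD _ _).
Qed.

Lemma norm1_cexp z : norm1 (cexp z) <= 2 * expR (Re z).
Proof.
rewrite /norm1 /= !normrM !(ger0_norm (expR_ge0 _)) -mulrDr mulrC.
rewrite ler_wpM2r ?expR_ge0//.
have := cos_max (Im z); have := sin_max (Im z); lra.
Qed.

End ComplexArithmetic.

(** * Hermite polynomials *)

Section Hermite.
Variable R : realType.
Implicit Types (s z : R[i]).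

(** The extension by zero lets neighbouring values of [l] be summed over one
    range of [j], without case distinctions on the parity of [l]. *)
Definition hermite_term (l j : nat) s : R[i] :=
  if (j.*2 <= l)%N then
    (-1) ^+ j / ((j`!)%:R * ((l - j.*2)`!)%:R) * (2 * s) ^+ (l - j.*2)
  else 0.

Lemma hermite_sum l N s : (l < N.*2)%N ->
  hermite l s = (l`!)%:R * \sum_(j < N) hermite_term l j s.
Proof.
move=> lN; rewrite /hermite; congr (_ * _).
have lN' : (l./2.+1 <= N)%N by lia.
rewrite (big_ord_widen_cond N predT
  (fun j => (-1) ^+ j / ((j`!)%:R * ((l - j.*2)`!)%:R) * (2 * s) ^+ (l - j.*2))
  lN') big_mkcond.
apply: eq_bigr => j _; rewrite /hermite_term /=.
have -> : (j < l./2.+1)%N = (j.*2 <= l)%N by apply/idP/idP; lia.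
by [].
Qed.

Lemma hermite_term_rec l j s :
  l.+2%:R * hermite_term l.+2 j.+1 s =
  2 * s * hermite_term l.+1 j.+1 s - 2 * hermite_term l j s.
Proof.
rewrite /hermite_term !doubleS !ltnS.
have [jl|jl] := leqP j.*2 l; last by rewrite ifF ?mulr0 ?subrr//; lia.
have factn0 n : (n`!)%:R != 0 :> R[i] by rewrite pnatr_eq0 -lt0n fact_gt0.
have Sn0 n : n.+1%:R != 0 :> R[i] by rewrite pnatr_eq0.
rewrite !subSS [(j.+1)`!]factS natrM exprS mulN1r.
case: ltnP => [jl'|jl'].
  have [m ml] : exists m, l = (m.+1 + j.*2)%N by exists (l - j.*2).-1; lia.
  rewrite ml addnK (_ : (m.+1 + j.*2 - j.*2.+1)%N = m); last by lia.
  rewrite [(m.+1)`!]factS natrM exprS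
    (_ : (m.+1 + j.*2).+2 = m.+1 + (j.+1).*2)%N; last by lia.
  rewrite natrD -muln2 natrM.
  have := factn0 j; have := factn0 m; have := Sn0 j; have := Sn0 m.
  move: (j`!)%:R (m`!)%:R => a b; rewrite -!natr1 -addrA.
  move: (j%:R : R[i]) (m%:R : R[i]) ((2 * s) ^+ m) ((-1) ^+ j) (2 * s)
    => j' m' x y z mn jn bn an.
  by field; rewrite an bn mn jn.
have <- : j.*2 = l by lia.
rewrite subnn fact0 mulr0 sub0r !expr0 !mulr1 -doubleS -muln2 natrM.
by field; rewrite factn0 addrC natr1 Sn0.
Qed.

Lemma hermite_term_rec0 l s :
  l.+2%:R * hermite_term l.+2 0 s = 2 * s * hermite_term l.+1 0 s.
Proof.
rewrite /hermite_term double0 !subn0 /= [(l.+2)`!]factS natrM [_ ^+ l.+2]exprS.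
have factn0 n : (n`!)%:R != 0 :> R[i] by rewrite pnatr_eq0 -lt0n fact_gt0.
have Sn0 n : n.+1%:R != 0 :> R[i] by rewrite pnatr_eq0.
field.
by rewrite !factn0 -natr1 -natr1 /=.
Qed.

Lemma hermite0 s : hermite 0 s = 1.
Proof. by rewrite /hermite /= big_ord1 fact0 !expr0 !mul1r invr1 mul1r. Qed.

Lemma hermite1 s : hermite 1 s = 2 * s.
Proof. by rewrite /hermite /= big_ord1 fact0 !mul1r invr1 mul1r. Qed.

(** The three-term recurrence holds between the terms of index [j + 1], [j + 1]
    and [j] of the three sums. *)
Lemma hermiteSS l s :
  hermite l.+2 s = 2 * s * hermite l.+1 s - 2 * l.+1%:R * hermite l s.
Proof.
have key : l.+2%:R * \sum_(j < l.+3) hermite_term l.+2 j s =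
    2 * s * \sum_(j < l.+3) hermite_term l.+1 j s
    - 2 * \sum_(j < l.+2) hermite_term l j s.
  rewrite [in LHS]big_ord_recl [in RHS]big_ord_recl !mulrDr.
  rewrite hermite_term_rec0 -addrA; congr (_ + _).
  by rewrite !mulr_sumr -sumrB; apply: eq_bigr => j _; exact: hermite_term_rec.
rewrite (@hermite_sum l.+2 l.+3) ?(@hermite_sum l.+1 l.+3)
  ?(@hermite_sum l l.+2); [|lia..].
rewrite !factS !natrM.
transitivity (l.+1%:R * l`!%:R * (l.+2%:R * \sum_(j < l.+3) hermite_term l.+2 j s)).
  by ring.
by rewrite key; ring.
Qed.

End Hermite.

(** * Directional derivatives of complex-valued functions *)

Section ComplexDerivative.
Variables (R : realType) (V : normedModType R).
Implicit Types (f g : V -> R[i]) (x v : V).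

Definition is_cderive x v f (d : R[i]) : Prop :=
  is_derive x v (fun y => Re (f y)) (Re d) /\
  is_derive x v (fun y => Im (f y)) (Im d).

Lemma is_cderive_eq x v f d d' : is_cderive x v f d -> d = d' ->
  is_cderive x v f d'.
Proof. by move=> ? <-. Qed.

Lemma is_cderive_cst x v (a : R[i]) : is_cderive x v (fun=> a) 0.
Proof. by split; exact: is_derive_cst. Qed.

Lemma is_cderiveD x v f g df dg : is_cderive x v f df ->
  is_cderive x v g dg -> is_cderive x v (fun y => f y + g y) (df + dg).
Proof.
move=> [fr fi] [gr gi]; split; rewrite ?ReD ?ImD.
  by under eq_fun do rewrite ReD; exact: is_deriveD.
by under eq_fun do rewrite ImD; exact: is_deriveD.
Qed.

Lemma is_cderiveM x v f g df dg : is_cderive x v f df ->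
  is_cderive x v g dg ->
  is_cderive x v (fun y => f y * g y) (df * g x + f x * dg).
Proof.
move=> [fr fi] [gr gi]; split.
  under eq_fun do rewrite ReM.
  have := is_deriveB (is_deriveM fr gr) (is_deriveM fi gi).
  by move/is_derive_eq; apply; rewrite /GRing.scale /= ReD !ReM; ring.
under eq_fun do rewrite ImM.
have := is_deriveD (is_deriveM fr gi) (is_deriveM fi gr).
by move/is_derive_eq; apply; rewrite /GRing.scale /= ImD !ImM; ring.
Qed.

Lemma is_cderiveZ x v f df (a : R[i]) : is_cderive x v f df ->
  is_cderive x v (fun y => a * f y) (a * df).
Proof.
move=> fd; have := is_cderiveM (is_cderive_cst x v a) fd.
by rewrite mul0r add0r.
Qed.

Lemma is_cderiveX x v f df n : is_cderive x v f df ->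
  is_cderive x v (fun y => f y ^+ n) (n%:R * f x ^+ n.-1 * df).
Proof.
move=> fd; elim: n => [|n IH].
  by rewrite !mul0r; exact: is_cderive_cst.
under eq_fun do rewrite exprS.
move/is_cderive_eq: (is_cderiveM fd IH); apply.
by case: n {IH} => [|n]; rewrite ?expr0 /= ?exprS -?natr1; ring.
Qed.

Lemma is_cderiveN x v f df : is_cderive x v f df ->
  is_cderive x v (fun y => - f y) (- df).
Proof.
move=> fd; rewrite -mulN1r; under eq_fun do rewrite -mulN1r.
exact: is_cderiveZ.
Qed.

Lemma is_cderiveB x v f g df dg : is_cderive x v f df ->
  is_cderive x v g dg -> is_cderive x v (fun y => f y - g y) (df - dg).
Proof. by move=> fd gd; exact/is_cderiveD/is_cderiveN. Qed.

Lemma is_cderive_sum x v n (f df : nat -> V -> R[i]) :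
  (forall i, is_cderive x v (f i) (df i x)) ->
  is_cderive x v (fun y => \sum_(i < n) f i y) (\sum_(i < n) df i x).
Proof.
move=> fd; elim: n => [|n IH].
  under eq_fun do rewrite big_ord0.
  by rewrite big_ord0; exact: is_cderive_cst.
under eq_fun do rewrite big_ord_recr.
by rewrite big_ord_recr; exact: is_cderiveD.
Qed.

(** The chain rule for a directional derivative, by restriction to the line
    through [x] directed by [v]. *)
Lemma is_derive_comp_dir (f : V -> R) (g : R -> R) x v df dg :
  is_derive x v f df -> is_derive (f x) 1 g dg ->
  is_derive x v (fun y => g (f y)) (dg * df).
Proof.
have line (k : V -> R) (d : R) :
    is_derive x v k d <-> is_derive (0 : R) 1 (fun t : R => k (t *: v + x)) d.
  have E : 'D_v k x = 'D_1 (fun t : R => k (t *: v + x)) 0.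
    rewrite /derive.
    set F1 := (X in lim (X @ _)); set F2 := (X in _ = lim (X @ _)).
    suff -> : F1 = F2 by [].
    apply/funext => t; rewrite /F1 /F2 /=.
    by rewrite scale0r add0r /GRing.scale /= mulr1 addr0.
  split=> -[kd <-].
    rewrite E; apply: derivableP. exact: (proj1 (derivable1P k x v) kd).
  rewrite -E; apply: derivableP; exact: (proj2 (derivable1P k x v) kd).
move=> /line fd gd; apply/line.
have gd' : is_derive (f (0 *: v + x)) 1 g dg by rewrite scale0r add0r.
exact: (is_derive1_comp gd' fd).
Qed.

Lemma is_cderive_cexp x v f df : is_cderive x v f df ->
  is_cderive x v (fun y => cexp (f y)) (cexp (f x) * df).
Proof.
move=> [fr fi].
have er := is_derive_comp_dir fr (is_derive_expR _).
have ec := is_derive_comp_dir fi (is_derive_cos _).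
have es := is_derive_comp_dir fi (is_derive_sin _).
split => /=.
  have := is_deriveM er ec.
  by move/is_derive_eq; apply; rewrite /GRing.scale /= ReM /=; ring.
have := is_deriveM er es.
by move/is_derive_eq; apply; rewrite /GRing.scale /= ImM /=; ring.
Qed.

(** The induction has two steps because the recurrence involves two
    predecessors; at [l = 0] the factor [l] hides the value of [l.-1]. *)
Lemma is_cderive_hermite x v f df l : is_cderive x v f df ->
  is_cderive x v (fun y => hermite l (f y))
    (2 * l%:R * hermite l.-1 (f x) * df).
Proof.
move=> fd; pose P l := is_cderive x v (fun y => hermite l (f y))
  (2 * l%:R * hermite l.-1 (f x) * df).
suff: P l /\ P l.+1 by case.
elim: l => [|l [IH0 IH1]]; rewrite ?/P /=.
  split.
    under eq_fun do rewrite hermite0.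
    by rewrite mulr0 !mul0r; exact: is_cderive_cst.
  under eq_fun do rewrite hermite1.
  by rewrite hermite0 !mulr1; exact: is_cderiveZ.
split=> //; under eq_fun do rewrite hermiteSS.
have := is_cderiveB (is_cderiveM (is_cderiveZ 2 fd) IH1)
  (is_cderiveZ (2 * l.+1%:R) IH0).
move/is_cderive_eq; apply.
case: l {IH0 IH1} => [|l]; first by rewrite hermite0 hermite1; ring.
by rewrite (hermiteSS l) -!natr1 /=; ring.
Qed.

End ComplexDerivative.

(** * Hermite functions *)

Section HermiteFunction.
Variable R : realType.
Implicit Types (s z : R[i]).

Definition hermite_function (l : nat) s : R[i] := cexp (- s ^+ 2) * hermite l s.

Lemma hermite_functionSS l s : hermite_function l.+2 s =
  2 * s * hermite_function l.+1 s - 2 * l.+1%:R * hermite_function l s.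
Proof. by rewrite /hermite_function hermiteSS; ring. Qed.

(** The Hermite functions are, up to sign, the successive derivatives of the
    Gaussian. *)
Lemma is_cderive_hermite_function (V : normedModType R) (x v : V) f df l :
  is_cderive x v f df ->
  is_cderive x v (fun y => hermite_function l (f y))
    (- hermite_function l.+1 (f x) * df).
Proof.
move=> fd; have := is_cderiveM (is_cderive_cexp
  (is_cderiveN (is_cderiveM fd fd))) (is_cderive_hermite l fd).
under eq_fun do rewrite -expr2.
move/is_cderive_eq; apply; rewrite /hermite_function -expr2.
by case: l => [|l]; rewrite ?hermite0 ?hermite1 ?hermiteSS /=; ring.
Qed.

Lemma exp_sum_le (x : R) N : 0 <= x ->
  \sum_(j < N) x ^+ j / (j`!)%:R <= expR x.
Proof.
move=> x0; rewrite -(big_mkord predT (fun j => x ^+ j / (j`!)%:R)).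
have := @nondecreasing_cvgn_le R (series (exp_coeff x)).
move=> /(_ _ (is_cvg_series_exp_coeff x) N); apply.
apply: nondecreasing_series => // n _ _.
exact: exp_coeff_ge0.
Qed.

Lemma exp_term_le (x : R) m : 0 <= x -> x ^+ m / (m`!)%:R <= expR x.
Proof.
move=> x0; apply: le_trans (exp_sum_le m.+1 x0).
by rewrite big_ord_recr /= lerDr sumr_ge0// => i _; rewrite divr_ge0// exprn_ge0.
Qed.

(** Cauchy's estimate for the generating function [exp (2 s t - t ^+ 2)] on
    the circle of radius [rho], read off the coefficients. *)
Lemma norm1_hermite l s (rho : R) : 0 < rho ->
  norm1 (hermite l s) <=
  (l`!)%:R / rho ^+ l * (expR (2 * rho * norm1 s) * expR (rho ^+ 2)).
Proof.
move=> rho0; have r0 := ltW rho0; have s0 := norm1_ge0 s.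
rewrite (@hermite_sum R l l.+1); last by lia.
rewrite -(rmorph_nat (real_complex R)) norm1Z normr_nat -mulrA.
rewrite ler_wpM2l// ler_pdivlMl ?exprn_gt0//.
have sum_le := exp_sum_le l.+1 (sqr_ge0 rho).
apply: le_trans (ler_wpM2l (expR_ge0 _) sum_le).
apply: le_trans (ler_wpM2l (exprn_ge0 l r0) (norm1_sum _ _ _)) _.
rewrite !mulr_sumr; apply: ler_sum => j _; rewrite /hermite_term.
case: ifPn => [jl|_]; last first.
  by rewrite norm10 mulr0 mulr_ge0 ?expR_ge0// divr_ge0 ?exprn_ge0 ?sqr_ge0.
have -> : (-1) ^+ j / (j`!%:R * (l - j.*2)`!%:R) =
    ((-1) ^+ j / (j`!%:R * (l - j.*2)`!%:R))%:C :> R[i].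
  by rewrite fmorph_div rmorphXn rmorphM rmorphN1 !rmorph_nat.
rewrite norm1Z normrM normrX normrN1 expr1n mul1r.
rewrite ger0_norm ?invr_ge0 ?mulr_ge0//.
have sX : norm1 ((2 * s) ^+ (l - j.*2)) <= (2 * norm1 s) ^+ (l - j.*2).
  apply: le_trans (norm1X _ _) _; rewrite lerXn2r ?nnegrE ?norm1_ge0 ?mulr_ge0//.
  by rewrite -[2]/(2%:R) -(rmorph_nat (real_complex R)) norm1Z normr_nat.
have El : rho ^+ l = rho ^+ (l - j.*2) * (rho ^+ 2) ^+ j.
  by rewrite -exprM -exprD mul2n subnK.
have T := exp_term_le (l - j.*2) (mulr_ge0 (mulr_ge0 (ler0n R 2) r0) s0).
apply: le_trans (ler_wpM2r _ T); last by rewrite divr_ge0 ?exprn_ge0 ?sqr_ge0.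
rewrite El invfM.
have -> : (2 * rho * norm1 s) ^+ (l - j.*2) =
    rho ^+ (l - j.*2) * (2 * norm1 s) ^+ (l - j.*2).
  by rewrite -exprMn mulrCA mulrA.
set a := rho ^+ (l - _); set b := (_ ^+ 2) ^+ j; set c := (2 * norm1 s) ^+ _ in sX *.
rewrite [leRHS](_ : _ = a * b * (j`!%:R^-1 * (l - j.*2)`!%:R^-1 * c)); last by ring.
rewrite ler_wpM2l ?mulr_ge0 ?exprn_ge0 ?sqr_ge0// ler_wpM2l//.
Qed.

End HermiteFunction.

(** * Taylor expansion of the Hermite functions *)

Section TaylorRemainder.
Variable R : realType.
Implicit Types (c x : R[i]) (r : R).

Lemma le_of_derive_le0 (f df : R -> R) (a b : R) : a <= b ->
  (forall r, is_derive r 1 f (df r)) -> (forall r, a <= r <= b -> df r <= 0) ->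
  f b <= f a.
Proof.
move=> ab fd df0.
have cf : {within `[a, b], continuous f}.
  apply: continuous_subspaceT => y; apply: differentiable_continuous.
  by apply/derivable1_diffP; case: (fd y).
have [y yab E] := MVT_segment ab (fun y _ => fd y) cf.
rewrite -subr_le0 E mulr_le0_ge0 ?subr_ge0//; apply: df0.
by move: yab; rewrite in_itv.
Qed.

Lemma norm_le_of_derive_le_pow (f df : R -> R) (K : R) N :
  (forall r, is_derive r 1 f (df r)) -> f 0 = 0 ->
  (forall r, 0 <= r <= 1 -> `|df r| <= K * r ^+ N) ->
  forall r, 0 <= r <= 1 -> `|f r| <= K * r ^+ N.+1 / N.+1%:R.
Proof.
move=> fd f0 dfK r /andP[r0 r1].
have pd (e x : R) : is_derive x 1 (fun y => e * f y - K * y ^+ N.+1 / N.+1%:R)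
    (e * df x - K * x ^+ N).
  have pX : is_derive x 1 (fun y : R => y ^+ N.+1) (N.+1%:R * x ^+ N).
    have := is_deriveX N.+1 (is_derive_id x 1); rewrite exprfctE.
    by move/is_derive_eq; apply; rewrite /GRing.scale /= mulr1.
  have := is_deriveB (is_deriveM (is_derive_cst e x 1) (fd x))
    (is_deriveM (is_deriveM (is_derive_cst K x 1) pX)
       (is_derive_cst (N.+1%:R^-1 : R) x 1)).
  have Sn0 : N.+1%:R != 0 :> R by rewrite pnatr_eq0.
  move/is_derive_eq; apply; rewrite /GRing.scale /= /cst.
  by field; rewrite addrC natr1 Sn0.
have bnd (e : R) : `|e| = 1 -> e * f r <= K * r ^+ N.+1 / N.+1%:R.
  move=> e1; rewrite -subr_le0.
  apply: le_trans (le_of_derive_le0 r0 (pd e) _) _; last first.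
    by rewrite f0 expr0n /= !mulr0 mul0r subrr.
  move=> y /andP[y0 yr]; rewrite subr_le0.
  apply: le_trans (ler_norm _) _; rewrite normrM e1 mul1r.
  by apply: dfK; rewrite y0 (le_trans yr).
rewrite ler_norml; apply/andP; split; last first.
  by have := bnd 1 (normr1 _); rewrite mul1r.
by rewrite lerNl; have := bnd (-1) (normrN1 _); rewrite mulN1r.
Qed.

(** The Taylor remainder at [x] of order [N]; since [hermite_function] shifts
    its index under differentiation, the coefficients are its own values. *)
Definition hermite_taylor_rem N l c x : R[i] :=
  hermite_function l (x + c) -
  \sum_(m < N) (- c) ^+ m / (m`!)%:R * hermite_function (l + m) x.

Lemma is_cderive_taylor_rem N l c x r :
  is_cderive r 1 (fun r : R => hermite_taylor_rem N.+1 l (r%:C * c) x)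
    (- c * hermite_taylor_rem N l.+1 (r%:C * c) x).
Proof.
have lin : is_cderive r 1 (fun r : R => r%:C * c) c.
  split; [under eq_fun do rewrite ReZ|under eq_fun do rewrite ImZ].
    have := is_deriveM (is_derive_id r 1) (is_derive_cst (Re c) r 1).
    by move/is_derive_eq; apply; rewrite /GRing.scale /= /cst; ring.
  have := is_deriveM (is_derive_id r 1) (is_derive_cst (Im c) r 1).
  by move/is_derive_eq; apply; rewrite /GRing.scale /= /cst; ring.
have line := is_cderiveD (is_cderive_cst r 1 x) lin.
pose T m (r : R) := (- (r%:C * c)) ^+ m / (m`!)%:R * hermite_function (l + m) x.
pose dT m (r : R) :=
  (m%:R * (- (r%:C * c)) ^+ m.-1 * - c) / (m`!)%:R * hermite_function (l + m) x.
have dTE m : is_cderive r 1 (T m) (dT m r).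
  have := is_cderiveZ ((m`!)%:R^-1 * hermite_function (l + m) x)
    (is_cderiveX m (is_cderiveN lin)).
  under eq_fun do rewrite mulrC mulrA.
  by move/is_cderive_eq; apply; rewrite /dT mulrC mulrA.
have := is_cderiveB (is_cderive_hermite_function l line)
  (is_cderive_sum N.+1 dTE).
move/is_cderive_eq; apply; rewrite /hermite_taylor_rem add0r.
have cong (a S S' : R[i]) : S = - c * S' -> - a * c - S = - c * (a - S').
  by move=> ->; ring.
rewrite big_ord_recl {1}/dT !mul0r add0r; apply: cong.
rewrite mulr_sumr; apply: eq_bigr => m _; rewrite /dT lift0 /=.
rewrite factS natrM addnS addSn.
have m0 : (m`!)%:R != 0 :> R[i] by rewrite pnatr_eq0 -lt0n fact_gt0.
have Sm0 : m.+1%:R != 0 :> R[i] by rewrite pnatr_eq0.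
by field; rewrite m0 addrC natr1 Sm0.
Qed.

(** The derivative along [c] of the remainder of order [N + 1] and index [l] is
    [- c] times the remainder of order [N] and index [l + 1], so the bound
    follows by integrating [N] times.  The factor [2] at each step is the price
    of treating real and imaginary parts separately. *)
Lemma norm1_taylor_rem N l c x (B : R) :
  (forall r, 0 <= r <= 1 ->
     norm1 (hermite_function (l + N) (x + r%:C * c)) <= B) ->
  forall r, 0 <= r <= 1 ->
  norm1 (hermite_taylor_rem N l (r%:C * c) x) <=
  (2 * norm1 c) ^+ N / (N`!)%:R * B * r ^+ N.
Proof.
elim: N l => [|N IH] l hB r r01.
  rewrite /hermite_taylor_rem big_ord0 subr0 !expr0 fact0 invr1 !mul1r mulr1.
  by rewrite -[l in leLHS]addn0; exact: hB.
have {}IH : forall r, 0 <= r <= 1 -> norm1 (hermite_taylor_rem N l.+1 (r%:C * c) x) <=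
  (2 * norm1 c) ^+ N / N`!%:R * B * r ^+ N.
  by apply: IH => t t01; rewrite addSnnS; exact: hB.
set K := norm1 c * ((2 * norm1 c) ^+ N / N`!%:R * B).
have bnd t : 0 <= t <= 1 ->
    norm1 (- c * hermite_taylor_rem N l.+1 (t%:C * c) x) <= K * t ^+ N.
  move=> t01; apply: le_trans (norm1M _ _) _.
  by rewrite norm1N /K -mulrA ler_wpM2l ?norm1_ge0// IH.
have at0 : hermite_taylor_rem N.+1 l (0%:C * c) x = 0.
  rewrite /hermite_taylor_rem mul0r addr0 big_ord_recl expr0 fact0 divr1 mul1r.
  rewrite addn0 big1 ?addr0 ?subrr// => i _.
  by rewrite /bump /= oppr0 expr0n /= !mul0r.
have half (P : R[i] -> R) : (forall z, `|P z| <= norm1 z) -> P 0 = 0 ->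
    (forall t : R, is_derive t 1
       (fun t : R => P (hermite_taylor_rem N.+1 l (t%:C * c) x))
       (P (- c * hermite_taylor_rem N l.+1 (t%:C * c) x))) ->
    `|P (hermite_taylor_rem N.+1 l (r%:C * c) x)| <= K * r ^+ N.+1 / N.+1%:R.
  move=> Ple P0 Pd; apply: (norm_le_of_derive_le_pow Pd) => //.
    by rewrite at0.
  by move=> t t01; exact: le_trans (Ple _) (bnd _ t01).
have hRe := half (@complex.Re R) (@Re_le_norm1 R) erefl
  (fun t => (is_cderive_taylor_rem N l c x t).1).
have hIm := half (@complex.Im R) (@Im_le_norm1 R) erefl
  (fun t => (is_cderive_taylor_rem N l c x t).2).
apply: le_trans (lerD hRe hIm) _.
have N0 : (N`!)%:R != 0 :> R by rewrite pnatr_eq0 -lt0n fact_gt0.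
have SN0 : N.+1%:R != 0 :> R by rewrite pnatr_eq0.
rewrite /K factS natrM le_eqVlt; apply/orP; left; apply/eqP.
by rewrite !exprS; field; rewrite N0 addrC natr1 SN0.
Qed.

Lemma leq_bin_exp n k : ('C(n, k) <= 2 ^ n)%N.
Proof.
elim: n k => [|n IH] [|k] //; first by rewrite bin0 expn_gt0.
by rewrite binS expnS mul2n -addnn leq_add.
Qed.

(** At bounded distance from the real axis the Gaussian decays like
    [exp (- x ^+ 2)] up to an exponential factor, so that it absorbs the
    exponential growth in Cauchy's estimate. *)
Lemma norm1_hermite_function_le (M rho : R) : 0 <= M -> 0 < rho ->
  exists2 K : R, 0 <= K & forall l (c : R[i]) (x : R), norm1 c <= M ->
    norm1 (hermite_function l (x%:C + c)) <=
    (l`!)%:R / rho ^+ l * K * expR (- `|x|).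
Proof.
move=> M0 rho0; set b := 2 * M + 2 * rho + 1.
exists (2 * expR (M ^+ 2 + 2 * rho * M + rho ^+ 2 + (b / 2) ^+ 2)).
  by rewrite mulr_ge0 ?expR_ge0.
move=> l c x cM; rewrite /hermite_function.
apply: le_trans (norm1M _ _) _.
apply: le_trans (ler_pM (norm1_ge0 _) (norm1_ge0 _) (norm1_cexp _)
  (norm1_hermite l _ rho0)) _.
rewrite mulrCA -[leRHS]mulrA ler_wpM2l ?divr_ge0 ?exprn_ge0 ?(ltW rho0)//.
rewrite -[leLHS]mulrA -[leRHS]mulrA ler_wpM2l// -!expRD ler_expR.
rewrite ReN expr2 ReM ReD ImD /= add0r.
have sz : norm1 (x%:C + c) <= `|x| + M.
  by apply: le_trans (norm1D _ _) _; rewrite norm1_real lerD2l.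
have {}sz : 2 * rho * norm1 (x%:C + c) <= 2 * rho * (`|x| + M).
  by rewrite ler_wpM2l// mulr_ge0// ltW.
have rc : `|Re c| <= M := le_trans (Re_le_norm1 c) cM.
have ic : `|Im c| <= M := le_trans (Im_le_norm1 c) cM.
have i2 : Im c * Im c <= M ^+ 2.
  by rewrite -expr2 -real_normK ?num_real// lerXn2r ?nnegrE.
have cross : - (2 * x * Re c) <= 2 * `|x| * M.
  apply: le_trans (ler_norm _) _; rewrite normrN !normrM normr_nat.
  by rewrite ler_wpM2l ?mulr_ge0.
have r2 : 0 <= Re c * Re c by rewrite -expr2 sqr_ge0.
(* completing the square in |x| produces the constant in K *)
have := sqr_ge0 (`|x| - b / 2).
have xx : `|x| * `|x| = x * x by rewrite -expr2 real_normK ?num_real// expr2.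
rewrite /b in sz cross *.
move: sz i2 cross r2 xx; rewrite !expr2; set a := `|x|; set u := Re c; set v := Im c.
by nra.
Qed.

(** Cauchy's estimate on a circle of radius [8 M] leaves a geometric gain over
    the powers of [2 c].  The uniformity in [c] and the weight in [x] are what
    allows principal values and sphere integrals to be taken term by term. *)
Lemma taylor_rem_decay l (M : R) : 1 <= M ->
  exists2 K : R, 0 <= K & forall N (c : R[i]) (x : R), norm1 c <= M ->
    norm1 (hermite_taylor_rem N l c x%:C) <= K / 2 ^+ N * expR (- `|x|).
Proof.
move=> M1; have M0 : 0 <= M by lra.
have rho0 : 0 < 8 * M by lra.
have [K K0 HK] := norm1_hermite_function_le M0 rho0.
exists (2 ^+ l * (l`!)%:R / (8 * M) ^+ l * K).
  by rewrite !mulr_ge0 ?invr_ge0 ?exprn_ge0//; lra.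
move=> N c x cM.
have := @norm1_taylor_rem N l c x%:C
  (((l + N)`!)%:R / (8 * M) ^+ (l + N) * K * expR (- `|x|)) _ 1.
rewrite ler01 lexx mul1r expr1n mulr1 => /(_ _ isT) H.
apply: le_trans (H _) _ => [r /andP[r0 r1]|].
  apply: HK; rewrite norm1Z ger0_norm//; apply: le_trans cM.
  by rewrite ler_piMl ?norm1_ge0.
rewrite !mulrA ler_wpM2r ?expR_ge0// [leRHS]mulrAC ler_wpM2r//.
have f0 : 0 < (N`!)%:R :> R by rewrite ltr0n fact_gt0.
have p0 k : 0 < (8 * M) ^+ k by rewrite exprn_gt0.
have t0 : 0 < 2 ^+ N :> R by rewrite exprn_gt0.
rewrite -(@ler_pM2r _ ((8 * M) ^+ (l + N)))//.
rewrite divfK ?gt_eqF// mulrAC.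
have fE : ((l + N)`!)%:R <= 2 ^+ (l + N) * ((l`!)%:R * (N`!)%:R) :> R.
  rewrite -(bin_fact (leq_addr N l)) addKn -!natrM -natrX -natrM.
  by rewrite ler_nat leq_mul2r leq_bin_exp orbT.
rewrite -mulrA; have cN : (2 * norm1 c) ^+ N <= (2 * M) ^+ N.
  by rewrite lerXn2r ?nnegrE ?mulr_ge0 ?norm1_ge0// ler_wpM2l.
apply: le_trans (ler_pM _ _ cN (ler_wpM2r _ fE)) _.
- by rewrite exprn_ge0// mulr_ge0 ?norm1_ge0.
- by rewrite divr_ge0.
- by rewrite invr_ge0 ltW.
rewrite le_eqVlt; apply/orP; left; apply/eqP.
rewrite !exprD (_ : (8 * M) ^+ N = 2 ^+ N * 2 ^+ N * (2 * M) ^+ N).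
  field.
  by rewrite !gt_eqF.
by rewrite -!exprMn; congr (_ ^+ _); ring.
Qed.

End TaylorRemainder.

(** * Affine changes of variable *)

Section AffineSubstitution.
Variable R : realType.
Local Notation mu := (@lebesgue_measure R).
Implicit Types (D : set (measurableTypeR R)) (f : R -> R).

(** Substitution along any map that multiplies the Lebesgue measure by a
    constant; reflections and increasing affine maps are the two instances. *)
Section Transfer.
Variables (phi : measurableTypeR R -> measurableTypeR R) (k : R).
Hypotheses (mphi : measurable_fun setT phi) (k0 : 0 < k).
Hypothesis mu_phi :
  forall A, measurable A -> (mu (phi @^-1` A) = k%:E * mu A)%E.

Let ge0_integral_transfer (D : set (measurableTypeR R))
    (f : measurableTypeR R -> \bar R) : measurable D ->
  measurable_fun D f -> (forall x, 0 <= f x)%E ->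
  (\int[mu]_(x in phi @^-1` D) f (phi x) = k%:E * \int[mu]_(x in D) f x)%E.
Proof.
move=> mD mf f0.
rewrite -(@ge0_integral_pushforward _ _ _ _ R phi mphi mu D f)//.
have kE : k%:E = (NngNum (ltW k0))%:num%:E by [].
rewrite kE -ge0_integral_mscale//.
by apply: eq_measure_integral => A mA _; exact: mu_phi.
Qed.

Lemma integrable_transfer D f : measurable D ->
  mu.-integrable D (EFin \o f) ->
  mu.-integrable (phi @^-1` D) (fun x => (f (phi x))%:E).
Proof.
move=> mD /integrableP[mf foo]; apply/integrableP; split.
  apply: (measurable_comp mD _ mf) => //; first by move=> y [x] /= Dx <-.
  exact: measurable_funTS.
rewrite (ge0_integral_transfer mD (f := fun x => (`|(f x)%:E|)%E))//.
  rewrite lte_mul_pinfty ?lee_fin ?(ltW k0)//.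
exact: measurableT_comp.
Qed.

Lemma Rintegral_transfer D f : measurable D ->
  mu.-integrable D (EFin \o f) ->
  \int[mu]_(x in phi @^-1` D) f (phi x) = k * \int[mu]_(x in D) f x.
Proof.
move=> mD intf; have [mf _] := integrableP _ _ _ intf.
have pos := ge0_integral_transfer mD (measurable_funepos mf) (funepos_ge0 _).
have neg := ge0_integral_transfer mD (measurable_funeneg mf) (funeneg_ge0 _).
have finp := integrable_pos_fin_num mD intf.
have finn := integrable_neg_fin_num mD intf.
transitivity (fine (\int[mu]_(x in phi @^-1` D) ((EFin \o f) \o phi) x)%E) => //.
rewrite /Rintegral (integralE mu D) (integralE mu (phi @^-1` D)).
rewrite funepos_comp funeneg_comp pos neg.
rewrite -muleBr//; last exact: fin_num_adde_defr.
by rewrite fineM// fin_numB; apply/andP.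
Qed.

End Transfer.

Lemma lebesgue_measure_affine (a b : R) (A : set R) : 0 < a -> measurable A ->
  mu ((fun x : measurableTypeR R => a * x + b) @^-1` A) = (a^-1%:E * mu A)%E.
Proof.
move=> a0 mA; pose phi (x : measurableTypeR R) : measurableTypeR R := a * x + b.
have mphi : measurable_fun setT phi.
  by apply: measurable_funD => //; exact: measurable_funM.
pose am : {nonneg R} := NngNum (ltW a0).
have pre (u v : R) : phi @^-1` `]u, v] = `](u - b) / a, (v - b) / a]%classic.
  apply/seteqP; split => x /=; rewrite !in_itv/= /phi.
    by rewrite ltr_pdivrMr// ler_pdivlMr// mulrC ltrBlDr lerBrDr.
  by rewrite ltr_pdivrMr// ler_pdivlMr// mulrC ltrBlDr lerBrDr.
have : mu A = mscale am (pushforward mu phi) A.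
  move=> m; apply: lebesgue_measure_unique => //= _ [[u v]] _ <-.
  change (mu `]u, v]%classic = (a%:E * mu (phi @^-1` `]u, v]%classic))%E).
  rewrite pre !lebesgue_measure_itv/= !lte_fin.
  rewrite ltr_pM2r ?invr_gt0// ltrD2r; case: ifPn => _; last by rewrite mule0.
  rewrite -!EFinD -EFinM; congr EFin.
  by field; rewrite gt_eqF.
rewrite /mscale /pushforward => /(_ mphi) ->.
by rewrite muleA -EFinM mulVf ?gt_eqF// mul1e.
Qed.

Lemma integrable_opp D f : measurable D -> mu.-integrable D (EFin \o f) ->
  mu.-integrable (-%R @^-1` D) (fun x => (f (- x))%:E).
Proof.
apply: (@integrable_transfer -%R 1) => // A mA.
by rewrite mul1e; exact: lebesgue_measureN.
Qed.

Lemma Rintegral_opp D f : measurable D -> mu.-integrable D (EFin \o f) ->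
  \int[mu]_(x in -%R @^-1` D) f (- x) = \int[mu]_(x in D) f x.
Proof.
move=> mD intf; rewrite -[RHS]mul1r.
apply: (@Rintegral_transfer -%R 1) => // A mA.
by rewrite mul1e; exact: lebesgue_measureN.
Qed.

Lemma Rintegral_affine (a b : R) D f : 0 < a -> measurable D ->
  mu.-integrable D (EFin \o f) ->
  \int[mu]_(x in (fun x => a * x + b) @^-1` D) f (a * x + b) =
  a^-1 * \int[mu]_(x in D) f x.
Proof.
move=> a0 mD intf; apply: Rintegral_transfer => //; rewrite ?invr_gt0//.
  by apply: measurable_funD => //; exact: measurable_funM.
by move=> A mA; exact: lebesgue_measure_affine.
Qed.

End AffineSubstitution.

(** * Principal values on the line *)

Section PrincipalValue.
Variable R : realType.
Local Notation mu := (@lebesgue_measure R).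
Implicit Types (f g : R -> R) (x e C : R).

Lemma is_derive_exp_decay (k x : R) :
  is_derive x 1 (fun y : R => k * expR (- y)) (- k * expR (- x)).
Proof.
have := is_deriveM (is_derive_cst k x 1)
  (is_derive_comp_dir (is_deriveN (is_derive_id x 1)) (is_derive_expR (- x))).
by move/is_derive_eq; apply; rewrite /GRing.scale /= /cst; ring.
Qed.

Lemma is_derive_continuous f (df : R -> R) :
  (forall x, is_derive x 1 f (df x)) -> continuous f.
Proof.
move=> fd x; apply: differentiable_continuous.
by apply/derivable1_diffP; case: (fd x).
Qed.

Lemma measurable_exp_decay (k : R) (D : set R) :
  measurable_fun D (fun x => (k * expR (- x))%:E).
Proof.
apply/measurable_EFinP; apply: measurable_funTS.
apply: continuous_measurable_fun.
exact: is_derive_continuous (is_derive_exp_decay k).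
Qed.

Lemma integral_exp_decay (K : R) : 0 <= K ->
  (\int[mu]_(x in `[0%R, +oo[) (K * expR (- x))%:E = K%:E)%E.
Proof.
move=> K0.
have dF (x : R) : is_derive x 1 (fun y : R => - K * expR (- y)) (K * expR (- x)).
  by have := is_derive_exp_decay (- K) x; rewrite opprK.
have cE k := is_derive_continuous (is_derive_exp_decay k).
rewrite (@ge0_continuous_FTC2y _ _ (fun y : R => - K * expR (- y)) 0 0).
- by rewrite oppr0 expR0 mulr1 sub0e EFinN oppeK.
- by move=> x _; rewrite mulr_ge0// expR_ge0.
- exact/continuous_subspaceT/cE.
- rewrite -[X in _ --> X](mulr0 (- K)); apply: cvgM; first exact: cvg_cst.
  exact: cvgr_expR.
- by move=> x _; case: (dF x).
- by apply: cvg_at_right_filter; exact: cE.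
- by move=> x _; rewrite derive1E; case: (dF x).
Qed.

Lemma integrable_exp_decay (K : R) : 0 <= K ->
  mu.-integrable `[0%R, +oo[ (fun x => (K * expR (- x))%:E).
Proof.
move=> K0; apply/integrableP; split.
  exact: measurable_exp_decay.
under eq_integral => x _ do rewrite gee0_abs ?lee_fin ?mulr_ge0 ?expR_ge0//.
by rewrite integral_exp_decay// ltry.
Qed.

Section Domination.
Variables (D : set (measurableTypeR R)) (h : R -> R) (K : R).
Hypotheses (mD : measurable D) (D0 : D `<=` `[0%R, +oo[) (K0 : 0 <= K).
Hypotheses (mh : measurable_fun D h)
  (hK : forall x, D x -> `|h x| <= K * expR (- x)).

Lemma integrable_dominated : mu.-integrable D (EFin \o h).
Proof.
apply: (@le_integrable _ _ _ _ _ mD _ (fun x => (K * expR (- x))%:E)).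
- exact/measurable_EFinP.
- move=> x Dx; rewrite lee_fin [leRHS]ger0_norm ?hK//.
  by rewrite mulr_ge0// expR_ge0.
- by apply: integrableS (integrable_exp_decay K0).
Qed.

Lemma Rintegral_dominated : `|\int[mu]_(x in D) h x| <= K.
Proof.
apply: le_trans (le_normr_Rintegral mD integrable_dominated) _.
have kE : K = fine (\int[mu]_(x in `[0%R, +oo[) (K * expR (- x))%:E).
  by rewrite integral_exp_decay.
rewrite kE; apply: fine_le.
- by apply: integrable_fin_num => //; exact: integrable_norm integrable_dominated.
- by rewrite integral_exp_decay.
apply: (@le_trans _ _ (\int[mu]_(x in D) (K * expR (- x))%:E)%E).
  apply: ge0_le_integral => //.
  - by apply/measurable_EFinP; apply: measurableT_comp.
  - exact: measurable_exp_decay.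
apply: ge0_subset_integral => //.
- exact: measurable_exp_decay.
- by move=> x _; rewrite lee_fin mulr_ge0// expR_ge0.
Qed.

End Domination.

(** The conditions under which the principal value of [g x / x] exists and is
    bounded by a multiple of [C]: decay at infinity, and a bounded derivative,
    which controls the difference quotient near the origin. *)
Definition decaying C g : Prop :=
  (forall x, `|g x| <= C * expR (- `|x|)) /\
  (exists2 dg : R -> R, forall x, is_derive x 1 g (dg x) &
     forall x, `|dg x| <= C).

Lemma decaying_continuous C g : decaying C g -> continuous g.
Proof. by move=> [_ [dg gd _]]; exact: is_derive_continuous gd. Qed.

Lemma decaying_ge0 C g : decaying C g -> 0 <= C.
Proof.
by move=> [gC _]; have := gC 0; rewrite normr0 oppr0 expR0 mulr1; exact: le_trans.
Qed.

Lemma decaying_lin C C' a f g : decaying C f -> decaying C' g ->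
  decaying (`|a| * C + C') (fun x => a * f x + g x).
Proof.
move=> [fC [df fd dfC]] [gC [dg gd dgC]]; split.
  move=> x; apply: le_trans (ler_normD _ _) _.
  by rewrite mulrDl normrM -mulrA lerD// ler_wpM2l.
exists (fun x => a * df x + dg x) => x.
  have := is_deriveD (is_deriveM (is_derive_cst a x 1) (fd x)) (gd x).
  by move/is_derive_eq; apply; rewrite /GRing.scale /= /cst; ring.
apply: le_trans (ler_normD _ _) _.
by rewrite normrM lerD// ler_wpM2l.
Qed.

Lemma decaying_opp C g : decaying C g -> decaying C (fun x => g (- x)).
Proof.
move=> [gC [dg gd dgC]]; split=> [x|]; first by rewrite -[`|x|]normrN.
exists (fun x => - dg (- x)) => x; last by rewrite normrN.
have := is_derive_comp_dir (is_deriveN (is_derive_id x 1)) (gd (- x)).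
by move/is_derive_eq; apply; rewrite mulrN1.
Qed.

(** Pairing [x] with [- x] turns the principal value of [g x / x] into an
    absolutely convergent integral over the half line. *)
Definition pv_integrand g x : R := (g x - g (- x)) / x.

Definition pv g : R := \int[mu]_(x in `]0%R, +oo[) pv_integrand g x.

(** Below 1 the mean value theorem bounds the integrand by [2 C], above 1 the
    decay of [g] does; the factor [expR 1] merges the two regimes. *)
Lemma pv_integrand_le C g x : decaying C g -> 0 < x ->
  `|pv_integrand g x| <= 2 * C * expR 1 * expR (- x).
Proof.
move=> gdec x0; have C0 := decaying_ge0 gdec; move: gdec => [gC [dg gd dgC]].
rewrite /pv_integrand normrM normfV (gtr0_norm x0) ler_pdivrMr//.
rewrite -mulrA -expRD.
have [x1|x1] := leP x 1.
  have cg : {within `[- x, x], continuous g}.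
    exact/continuous_subspaceT/(is_derive_continuous gd).
  have [|y _ ->] := MVT_segment _ (fun y _ => gd y) cg.
    by rewrite ge0_cp// ltW.
  rewrite opprK normrM (_ : x + x = 2 * x); last by ring.
  rewrite normrM (ger0_norm (ltW x0)) normr_nat.
  apply: (@le_trans _ _ (C * (2 * x))); first by rewrite ler_wpM2r// mulr_ge0// ltW.
  rewrite mulrCA mulrA ler_wpM2r ?(ltW x0)// ler_peMr ?mulr_ge0//.
  by rewrite -[leLHS]expR0 ler_expR subr_ge0.
apply: le_trans (ler_normB _ _) _.
have := gC x; have := gC (- x); rewrite normrN (gtr0_norm x0) => g1 g2.
apply: le_trans (lerD g2 g1) _.
rewrite [leLHS](_ : _ = 2 * C * expR (- x)); last by ring.
rewrite -[leRHS]mulrA ler_wpM2l ?mulr_ge0//.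
apply: (@le_trans _ _ (expR (1 - x))); first by rewrite ler_expR lerDr.
by rewrite ler_peMr ?expR_ge0// ltW.
Qed.

Lemma measurable_div_id C g : decaying C g ->
  measurable_fun (`]0%R, +oo[%classic : set R) (fun x => g x / x).
Proof.
move=> gdec; apply: open_continuous_measurable_fun => // x.
rewrite inE/= in_itv/= andbT => x0; apply: cvgM.
  exact: decaying_continuous gdec x.
by apply: cvgV; rewrite ?gt_eqF//; exact: cvg_id.
Qed.

Lemma decaying_odd C g : decaying C g ->
  decaying (C + C) (fun x => g x - g (- x)).
Proof.
move=> gdec; have := decaying_lin (-1) (decaying_opp gdec) gdec.
rewrite normrN1 mul1r; under eq_fun do rewrite mulN1r addrC.
by [].
Qed.

Lemma measurable_pv_integrand C g : decaying C g ->
  measurable_fun (`]0%R, +oo[%classic : set R) (pv_integrand g).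
Proof. by move/decaying_odd/measurable_div_id. Qed.

Section HalfLine.
Variables (a C : R) (g : R -> R).
Hypotheses (a0 : 0 <= a) (gdec : decaying C g).

Let half_sub : `]a, +oo[ `<=` `]0, +oo[.
Proof.
by move=> x /=; rewrite !in_itv/= !andbT; exact: le_lt_trans.
Qed.

Let half_sub0 : `]a, +oo[ `<=` `[0, +oo[.
Proof.
by move=> x /half_sub/=; rewrite !in_itv/= !andbT; exact: ltW.
Qed.

Let K0 : 0 <= 2 * C * expR 1.
Proof. by rewrite !mulr_ge0 ?expR_ge0// (decaying_ge0 gdec). Qed.

Let mpv : measurable_fun (`]a, +oo[%classic : set R) (pv_integrand g).
Proof. exact: measurable_funS (measurable_pv_integrand gdec). Qed.

Let pvle x : `]a, +oo[%classic x ->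
  `|pv_integrand g x| <= 2 * C * expR 1 * expR (- x).
Proof.
by move=> /half_sub/=; rewrite in_itv/= andbT; exact: pv_integrand_le.
Qed.

Lemma integrable_pv_integrand :
  mu.-integrable `]a, +oo[ (EFin \o pv_integrand g).
Proof. exact: (integrable_dominated _ half_sub0 K0). Qed.

Lemma Rintegral_pv_integrand_le :
  `|\int[mu]_(x in `]a, +oo[) pv_integrand g x| <= 2 * C * expR 1.
Proof. exact: (Rintegral_dominated _ half_sub0 K0). Qed.

End HalfLine.

Lemma pv_le C g : decaying C g -> `|pv g| <= 2 * C * expR 1.
Proof. exact: Rintegral_pv_integrand_le. Qed.

Lemma pv_lin C C' a f g : decaying C f -> decaying C' g ->
  pv (fun x => a * f x + g x) = a * pv f + pv g.
Proof.
move=> fdec gdec; have fi := integrable_pv_integrand (lexx 0) fdec.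
have gi := integrable_pv_integrand (lexx 0) gdec.
have mD : measurable (`]0, +oo[%classic : set (measurableTypeR R)) by [].
rewrite /pv -RintegralZl// -RintegralD//; last exact: (integrableZl mD a fi).
by apply: eq_Rintegral => x _; rewrite /pv_integrand; ring.
Qed.

Lemma pv_opp C g : decaying C g -> pv (fun x => g (- x)) = - pv g.
Proof.
move=> gdec; have gi := integrable_pv_integrand (lexx 0) gdec.
rewrite /pv -mulN1r -RintegralZl//.
by apply: eq_Rintegral => x _; rewrite /pv_integrand opprK; ring.
Qed.

Lemma integrable_setU (A B : set (measurableTypeR R)) (h : R -> R) :
  measurable A -> measurable B -> [disjoint A & B] ->
  mu.-integrable A (EFin \o h) -> mu.-integrable B (EFin \o h) ->
  mu.-integrable (A `|` B) (EFin \o h).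
Proof.
move=> mA mB AB /integrableP[hA A_fin] /integrableP[hB B_fin].
have hAB : measurable_fun (A `|` B) (EFin \o h) by exact/measurable_funU.
apply/integrableP; split=> //.
rewrite ge0_integral_setU//; last exact: measurableT_comp.
by rewrite lte_add_pinfty.
Qed.

Section Truncation.
Variables (e C : R) (g : R -> R).
Hypotheses (e0 : 0 < e) (gdec : decaying C g).
Let P : set (measurableTypeR R) := `]e, +oo[%classic.
Let mP : measurable P. Proof. exact: measurable_itv. Qed.

Let integrable_half f : decaying C f -> mu.-integrable P (fun x => (f x / x)%:E).
Proof.
move=> fdec; have C0 := decaying_ge0 fdec.
apply: (@integrable_dominated P (fun x => f x / x) (C / e)) => //.
- by move=> x; rewrite /P /= !in_itv/= !andbT => ex; rewrite ltW// (lt_trans e0).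
- by rewrite divr_ge0// ltW.
- apply: measurable_funS (measurable_div_id fdec) => // x.
  by rewrite /P /= !in_itv/= !andbT; exact: lt_trans.
move=> x; rewrite /P /= in_itv/= andbT => ex; have x0 := lt_trans e0 ex.
case: fdec => + _ => /(_ x); rewrite normrM normfV (gtr0_norm x0) => fx.
rewrite mulrAC ler_pM ?invr_ge0 ?(ltW x0)//.
by rewrite lef_pV2 ?posrE// ltW.
Qed.

Let far_split : [set x : R | e < `|x|] = P `|` -%R @^-1` P.
Proof.
apply/seteqP; split => x; rewrite /P /= !in_itv/= !andbT lter_normr.
  by case/orP; [left|right].
by case=> ->; rewrite ?orbT.
Qed.

Let P_disj : [disjoint P & -%R @^-1` P].
Proof.
apply/eqP; rewrite -subset0 => x []; rewrite /P /= !in_itv/= !andbT => ex ex'.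
have x0 := lt_trans e0 ex; have := lt_trans e0 ex'.
by rewrite oppr_gt0 ltNge (ltW x0).
Qed.

Let mNP : measurable (-%R @^-1` P).
Proof. by rewrite /P opp_preimage_itvbndy; exact: measurable_itv. Qed.

Let integrable_neg_half : mu.-integrable P (fun x => (g (- x) / - x)%:E).
Proof.
have := integrable_half (decaying_opp gdec).
move/(integrableZl mP (-1)); apply: eq_integrable => // x _.
by rewrite -EFinM invrN mulrN mulN1r.
Qed.

Let integrable_left : mu.-integrable (-%R @^-1` P) (fun x => (g x / x)%:E).
Proof.
have := integrable_opp mP integrable_neg_half.
by apply: eq_integrable => // x _; rewrite opprK.
Qed.

Lemma integrable_far : mu.-integrable [set x : R | e < `|x|] (fun x => (g x / x)%:E).
Proof.
rewrite far_split; apply: integrable_setU => //.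
exact: integrable_half gdec.
Qed.

Lemma Rintegral_far : \int[mu]_(x in [set x : R | e < `|x|]) (g x / x) =
  \int[mu]_(x in `]e, +oo[) pv_integrand g x.
Proof.
have gi := integrable_half gdec.
have := integrable_far; rewrite far_split => gE.
rewrite (Rintegral_setU mP mNP gE P_disj).
have -> : \int[mu]_(x in -%R @^-1` P) (g x / x) =
    \int[mu]_(x in P) (g (- x) / - x).
  rewrite -(Rintegral_opp mP integrable_neg_half).
  by apply: eq_Rintegral => x _; rewrite opprK.
rewrite -RintegralD//; apply: eq_Rintegral => x _.
by rewrite /pv_integrand invrN mulrN -mulrBl.
Qed.

End Truncation.

(** The part of the integral below [e] is at most a constant times [e], since
    the symmetrized integrand is bounded. *)
Lemma pv_lim C g : decaying C g ->
  \int[mu]_(x in [set x : R | e < `|x|]) (g x / x) @[e --> 0^'+] --> pv g.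
Proof.
move=> gdec; have C0 := decaying_ge0 gdec.
pose K := 2 * C * expR 1 + 1.
have K1 : 0 < K by rewrite ltr_wpDl// !mulr_ge0 ?expR_ge0.
apply/cvgrPdist_le => /= eps eps0; near=> e.
have e0 : 0 < e by near: e; exact: nbhs_right_gt.
have eK : e * K <= eps.
  by rewrite -ler_pdivlMr//; near: e; apply: nbhs_right_le; rewrite divr_gt0.
rewrite (Rintegral_far e0 gdec) /pv.
have gi := integrable_pv_integrand (lexx 0) gdec.
have gie := integrable_pv_integrand (ltW e0) gdec.
have mA : measurable (`]0, e]%classic : set (measurableTypeR R)) by [].
have mB : measurable (`]e, +oo[%classic : set (measurableTypeR R)) by [].
have muA : mu (`]0, e]%classic : set (measurableTypeR R)) = e%:E.
  by rewrite lebesgue_measure_itv/= lte_fin e0 /= -EFinB subr0.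
have AB : [disjoint (`]0, e]%classic : set (measurableTypeR R)) & `]e, +oo[%classic].
  apply/eqP; rewrite -subset0 => x /= []; rewrite !in_itv/= andbT => /andP[_ xe].
  by rewrite ltNge xe.
have split0 : `]0, +oo[%classic = `]0, e] `|` `]e, +oo[ :> set R.
  apply/seteqP; split => x /=; rewrite !in_itv/= !andbT.
    by move=> x0; case: (leP x e) => xe; [left; rewrite x0|right].
  by case=> [/andP[]//|]; exact: lt_trans.
have giU := gi; rewrite split0 in giU.
rewrite [X in X - _](_ : _ =
  \int[mu]_(x in `]0, e] `|` `]e, +oo[) pv_integrand g x); last by rewrite -split0.
rewrite (Rintegral_setU mA mB giU AB) addrK.
have giA : mu.-integrable `]0, e] (EFin \o pv_integrand g).
  by apply: integrableS gi => //; rewrite split0; exact: subsetUl.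
apply: le_trans (le_normr_Rintegral mA giA) _; apply: le_trans eK.
apply: (@le_trans _ _ (\int[mu]_(x in `]0, e]) K)).
  apply: le_Rintegral => //.
  - exact: integrable_norm giA.
  - apply: measurable_bounded_integrable => //.
    + by apply: (@le_lt_trans _ _ e%:E); [rewrite -muA|exact: ltry].
    + exists K; split; first exact: num_real.
      by move=> y Ky x _ /=; rewrite (le_trans _ (ltW Ky))// gtr0_norm.
  move=> x /=; rewrite in_itv/= => /andP[x0 _].
  apply: le_trans (pv_integrand_le gdec x0) _.
  apply: (@le_trans _ _ (2 * C * expR 1)); last by rewrite lerDl.
  by rewrite ler_piMr ?mulr_ge0 ?expR_ge0// expR_le1 oppr_le0 ltW.
by rewrite Rintegral_cst// [X in fine X]muA mulrC.
Unshelve. all: by end_near. Qed.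

End PrincipalValue.

(** * Hilbert transforms of the Hermite functions *)

Section HermiteHilbert.
Variable R : realType.
Local Notation mu := (@lebesgue_measure R).
Implicit Types (f g : R -> R[i]) (x e C : R) (c a : R[i]).

Definition cdecaying C g : Prop :=
  decaying C (fun x => Re (g x)) /\ decaying C (fun x => Im (g x)).

Definition cpv g : R[i] := pv (fun x => Re (g x)) +i* pv (fun x => Im (g x)).

Lemma decaying_le C C' (g : R -> R) : C <= C' -> decaying C g -> decaying C' g.
Proof.
move=> CC' [gC [dg gd dgC]]; split=> [x|].
  by apply: le_trans (gC x) _; rewrite ler_wpM2r ?expR_ge0.
by exists dg => // x; exact: le_trans (dgC x) CC'.
Qed.

Lemma cdecaying_lin C C' a f g : cdecaying C f -> cdecaying C' g ->
  cdecaying (norm1 a * C + C') (fun x => a * f x + g x).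
Proof.
move=> [fr fi] [gr gi]; split.
  have := decaying_lin (Re a) fr (decaying_lin (- Im a) fi gr).
  rewrite normrN addrA -mulrDl; congr (decaying _ _).
  by apply/funext => x; rewrite ReD ReM; ring.
have := decaying_lin (Re a) fi (decaying_lin (Im a) fr gi).
rewrite addrA -mulrDl; congr (decaying _ _).
by apply/funext => x; rewrite ImD ImM; ring.
Qed.

Lemma cpv_lin C C' a f g : cdecaying C f -> cdecaying C' g ->
  cpv (fun x => a * f x + g x) = a * cpv f + cpv g.
Proof.
move=> [fr fi] [gr gi].
have Ere := pv_lin (Re a) fr (decaying_lin (- Im a) fi gr).
have Eim := pv_lin (Re a) fi (decaying_lin (Im a) fr gi).
rewrite (pv_lin (- Im a) fi gr) in Ere; rewrite (pv_lin (Im a) fr gi) in Eim.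
apply: complexP; rewrite ?ReD ?ImD ?ReM ?ImM /cpv /=.
  rewrite -[RHS](_ : Re a * pv (fun x => Re (f x)) +
    (- Im a * pv (fun x => Im (f x)) + pv (fun x => Re (g x))) = _); last by ring.
  by rewrite -Ere; congr pv; apply/funext => x; rewrite ReD ReM; ring.
rewrite -[RHS](_ : Re a * pv (fun x => Im (f x)) +
  (Im a * pv (fun x => Re (f x)) + pv (fun x => Im (g x))) = _); last by ring.
by rewrite -Eim; congr pv; apply/funext => x; rewrite ImD ImM; ring.
Qed.

Lemma cpv_le C g : cdecaying C g -> norm1 (cpv g) <= 4 * C * expR 1.
Proof.
move=> [gr gi]; apply: le_trans (lerD (pv_le gr) (pv_le gi)) _.
by rewrite le_eqVlt; apply/orP; left; apply/eqP; ring.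
Qed.

Lemma decaying0 : decaying 0 (fun=> 0 : R).
Proof.
split=> [x|]; first by rewrite normr0 mul0r.
by exists (fun=> 0) => x; [exact: is_derive_cst|rewrite normr0].
Qed.

Lemma cdecaying0 : cdecaying 0 (fun=> 0).
Proof. by split; exact: decaying0. Qed.

Lemma cpv0 : cpv (fun=> 0) = 0.
Proof.
apply: norm1_eq0; apply: le_trans (cpv_le cdecaying0) _.
by rewrite mulr0 mul0r.
Qed.

Lemma cpv_sum N (C : nat -> R) (a : nat -> R[i]) (f : nat -> R -> R[i]) :
  (forall m, cdecaying (C m) (f m)) ->
  (exists C', cdecaying C' (fun x => \sum_(m < N) a m * f m x)) /\
  cpv (fun x => \sum_(m < N) a m * f m x) = \sum_(m < N) a m * cpv (f m).
Proof.
move=> fdec; elim: N => [|N [[C' IHd] IH]].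
  have -> : (fun x => \sum_(m < 0) a m * f m x) = (fun=> 0).
    by apply/funext => x; rewrite big_ord0.
  by rewrite big_ord0 cpv0; split=> //; exists 0; exact: cdecaying0.
have -> : (fun x => \sum_(m < N.+1) a m * f m x) =
    (fun x => a N * f N x + \sum_(m < N) a m * f m x).
  by apply/funext => x; rewrite big_ord_recr addrC.
split; first by exists (norm1 (a N) * C N + C'); exact: cdecaying_lin.
by rewrite (cpv_lin _ (fdec N) IHd) IH big_ord_recr addrC.
Qed.

Lemma is_cderive_taylor_rem_x N l c x :
  is_cderive x 1 (fun x : R => hermite_taylor_rem N l c x%:C)
    (- hermite_taylor_rem N l.+1 c x%:C).
Proof.
have idx : is_cderive x 1 (fun x : R => x%:C) 1.
  by split => /=; [exact: is_derive_id|exact: is_derive_cst].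
have line := is_cderiveD idx (is_cderive_cst x 1 c).
pose dT m (x : R) := (- c) ^+ m / (m`!)%:R * (- hermite_function (l + m).+1 x%:C * 1).
have dTE m := is_cderiveZ ((- c) ^+ m / (m`!)%:R)
  (is_cderive_hermite_function (l + m) idx).
have := is_cderiveB (is_cderive_hermite_function l line)
  (is_cderive_sum N (df := dT) dTE).
move/is_cderive_eq; apply; rewrite /hermite_taylor_rem addr0 mulr1 opprB addrC.
rewrite -sumrN; congr (_ + _); apply: eq_bigr => m _.
by rewrite /dT mulr1 mulrN opprK addSn.
Qed.

Lemma taylor_rem_cdecaying l (M : R) : 1 <= M ->
  exists2 K : R, 0 <= K & forall N c, norm1 c <= M ->
    cdecaying (K / 2 ^+ N) (fun x => hermite_taylor_rem N l c x%:C).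
Proof.
move=> M1; have [K K0 HK] := taylor_rem_decay l M1.
have [K' K'0 HK'] := taylor_rem_decay l.+1 M1.
exists (K + K') => [|N c cM]; first exact: addr_ge0.
have p2 : 0 < (2 : R) ^+ N by rewrite exprn_gt0.
have b0 x : norm1 (hermite_taylor_rem N l c x%:C) <= (K + K') / 2 ^+ N * expR (- `|x|).
  apply: le_trans (HK N c x cM) _.
  by rewrite ler_wpM2r ?expR_ge0// ler_wpM2r ?invr_ge0 ?(ltW p2)// lerDl.
have b1 x : norm1 (hermite_taylor_rem N l.+1 c x%:C) <= (K + K') / 2 ^+ N.
  apply: le_trans (HK' N c x cM) _.
  apply: (@le_trans _ _ (K' / 2 ^+ N)).
    by rewrite ler_piMr ?divr_ge0 ?(ltW p2)// -[leRHS]expR0 ler_expR oppr_le0.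
  by rewrite ler_wpM2r ?invr_ge0 ?(ltW p2)// lerDr.
split; split.
- by move=> x; exact: le_trans (Re_le_norm1 _) (b0 x).
- exists (fun x => Re (- hermite_taylor_rem N l.+1 c x%:C)) => x.
    by case: (is_cderive_taylor_rem_x N l c x).
  by rewrite ReN normrN; exact: le_trans (Re_le_norm1 _) (b1 x).
- by move=> x; exact: le_trans (Im_le_norm1 _) (b0 x).
- exists (fun x => Im (- hermite_taylor_rem N l.+1 c x%:C)) => x.
    by case: (is_cderive_taylor_rem_x N l c x).
  by rewrite ImN normrN; exact: le_trans (Im_le_norm1 _) (b1 x).
Qed.

Lemma hermite_function_cdecaying l c :
  exists C, cdecaying C (fun x => hermite_function l (x%:C + c)).
Proof.
have [|K _ HK] := @taylor_rem_cdecaying l (1 + norm1 c).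
  by rewrite lerDl norm1_ge0.
exists (K / 2 ^+ 0); have := HK 0%N c; rewrite lerDr ler01 => /(_ isT).
congr (cdecaying _ _); apply/funext => x.
by rewrite /hermite_taylor_rem big_ord0 subr0.
Qed.

(** Up to sign, the Hilbert transform of [hermite_function l], continued to
    complex arguments. *)
Definition hermite_hilbert l c : R[i] :=
  cpv (fun x => hermite_function l (x%:C + c)).

Definition hermite_moment l : R[i] := cpv (fun x => hermite_function l x%:C).

(** The principal value is linear and continuous for the norm [decaying], in
    which the Taylor remainders tend to zero geometrically: hence the Taylor
    coefficients at the origin are principal values of Hermite functions. *)
Lemma hermite_hilbert_series l (M : R) : 1 <= M ->
  exists2 K : R, 0 <= K & forall N c, norm1 c <= M ->
    norm1 (hermite_hilbert l c -
      \sum_(m < N) (- c) ^+ m / (m`!)%:R * hermite_moment (l + m)) <= K / 2 ^+ N.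
Proof.
move=> M1; have [K K0 HK] := taylor_rem_cdecaying l M1.
exists (4 * K * expR 1) => [|N c cM]; first by rewrite !mulr_ge0 ?expR_ge0.
have cdec m : exists C, cdecaying C (fun x => hermite_function (l + m) x%:C).
  have [C] := hermite_function_cdecaying (l + m) 0.
  by under eq_fun do rewrite addr0; exists C.
have [C HC] := choice cdec.
have [[C' sdec] <-] := @cpv_sum N _ (fun m => (- c) ^+ m / (m`!)%:R) _ HC.
have [C0 cdec0] := hermite_function_cdecaying l c.
rewrite addrC -mulN1r -(cpv_lin (-1) sdec cdec0).
have := HK N c cM.
have -> : (fun x => hermite_taylor_rem N l c x%:C) =
  (fun x => -1 * (\sum_(m < N) (- c) ^+ m / (m`!)%:R * hermite_function (l + m) x%:C)
     + hermite_function l (x%:C + c)).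
  by apply/funext => x; rewrite /hermite_taylor_rem mulN1r addrC.
move/cpv_le/le_trans; apply.
by rewrite le_eqVlt; apply/orP; left; apply/eqP; ring.
Qed.

Lemma hermite_function_series l (M : R) : 1 <= M ->
  exists2 K : R, 0 <= K & forall N c, norm1 c <= M ->
    norm1 (hermite_function l c -
      \sum_(m < N) (- c) ^+ m / (m`!)%:R * hermite_function (l + m) 0)
    <= K / 2 ^+ N.
Proof.
move=> M1; have [K K0 HK] := taylor_rem_decay l M1.
exists K => // N c cM; have := HK N c 0 cM.
by rewrite normr0 oppr0 expR0 mulr1 /hermite_taylor_rem add0r.
Qed.

End HermiteHilbert.

(** * Moments of the Hermite functions *)

Section HermiteMoments.
Variable R : realType.
Local Notation mu := (@lebesgue_measure R).
Implicit Types (g : R -> R) (x C : R).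

Lemma Rintegral_half_line (f : R -> R) :
  measurable_fun (`]0, +oo[%classic : set R) (EFin \o f) ->
  \int[mu]_(x in (`]0%R, +oo[%classic : set R)) f x = \int[mu]_(x in `[0%R, +oo[) f x.
Proof. by move=> mf; rewrite /Rintegral integral_itv_obnd_cbnd. Qed.

(** The factor [x] cancels the singularity and leaves the integral of a
    derivative over the line.  Adding an exponential makes the symmetrized
    integrand nonnegative, so that the fundamental theorem of calculus applies
    on the half line. *)
Lemma pv_mulx_derive C (g dg : R -> R) : decaying C g ->
  (forall x, is_derive x 1 g (dg x)) -> decaying C dg ->
  pv (fun x => x * dg x) = 0.
Proof.
move=> gdec gd dgdec; have C0 := decaying_ge0 gdec.
have cdg := decaying_continuous dgdec.
have cg := decaying_continuous gdec.
case: gdec dgdec => gC _ [dgC _].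
pose s x := dg x + dg (- x).
pose H x := s x + 2 * C * expR (- x).
pose F x := g x - g (- x) + - (2 * C) * expR (- x).
have Fd x : is_derive x 1 F (H x).
  have := is_deriveD (is_deriveB (gd x)
    (is_derive_comp_dir (is_deriveN (is_derive_id x 1)) (gd (- x))))
    (is_derive_exp_decay (- (2 * C)) x).
  by move/is_derive_eq; apply; rewrite /H /s; ring.
have cs : continuous s.
  move=> x; apply: cvgD; first exact: cdg.
  by apply: (@continuous_comp _ _ _ -%R dg); [exact: opp_continuous|exact: cdg].
have cE : continuous (fun x : R => 2 * C * expR (- x)).
  exact: is_derive_continuous (is_derive_exp_decay _).
have cH : continuous H by move=> x; apply: cvgD; [exact: cs|exact: cE].
have s_le x : 0 <= x -> `|s x| <= 2 * C * expR (- x).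
  move=> x0; apply: le_trans (ler_normD _ _) _.
  have := dgC x; have := dgC (- x); rewrite normrN (ger0_norm x0) => h1 h2.
  by rewrite [leRHS](_ : _ = C * expR (- x) + C * expR (- x)) ?lerD//; ring.
have F_lim : F x @[x --> +oo] --> (0 : R).
  have e0 : (4 * C * expR (- x) @[x --> +oo] --> (0 : R)).
    rewrite -[X in _ --> X](mulr0 (4 * C)).
    by apply: cvgM; [exact: cvg_cst|exact: cvgr_expR].
  apply/norm_cvg0P; apply: (squeeze_cvgr _ (cvg_cst 0) e0).
  near=> x; rewrite normr_ge0 /=.
  have x0 : 0 <= x by near: x; exact: nbhs_pinfty_ge.
  have := gC x; have := gC (- x); rewrite normrN (ger0_norm x0) => h1 h2.
  apply: le_trans (ler_normD _ _) _.
  apply: le_trans (lerD (ler_normB _ _) (lexx _)) _.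
  rewrite mulNr !normrN [X in _ + X <= _]ger0_norm ?mulr_ge0 ?expR_ge0//.
  by rewrite [leRHS](_ : _ =
    C * expR (- x) + C * expR (- x) + 2 * C * expR (- x)) ?lerD//; ring.
have intH : (\int[mu]_(x in `[0%R, +oo[) (H x)%:E = 0%:E - (F 0)%:E)%E.
  apply: ge0_continuous_FTC2y F_lim _ _ _.
  - move=> x x0; have := s_le x x0; rewrite ler_norml => /andP[+ _].
    by rewrite /H; lra.
  - exact: continuous_subspaceT.
  - by move=> x _; case: (Fd x).
  - by apply: cvg_at_right_filter; exact: is_derive_continuous Fd 0.
  - by move=> x _; rewrite derive1E; case: (Fd x).
have is_s : mu.-integrable `[0%R, +oo[ (EFin \o s).
  apply: (@integrable_dominated _ _ s (2 * C)) => //.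
  - by rewrite mulr_ge0.
  - by apply: measurable_funTS; exact: continuous_measurable_fun.
  - by move=> x /=; rewrite in_itv/= andbT; exact: s_le.
have is_e := integrable_exp_decay (mulr_ge0 (ler0n R 2) C0).
have : \int[mu]_(x in `[0%R, +oo[) (s x + 2 * C * expR (- x)) = 2 * C.
  rewrite /Rintegral intH /F /= oppr0 expR0.
  by ring.
rewrite RintegralD//.
have -> : \int[mu]_(x in `[0%R, +oo[) (2 * C * expR (- x)) = 2 * C.
  by rewrite /Rintegral integral_exp_decay// mulr_ge0.
move=> /eqP; rewrite -subr_eq0 addrK => /eqP s0.
rewrite /pv -[RHS]s0 -Rintegral_half_line; last first.
  by apply/measurable_EFinP/measurable_funTS; exact: continuous_measurable_fun.
apply: eq_Rintegral => x; rewrite inE/= in_itv/= andbT => x0.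
by rewrite /pv_integrand /s; field; rewrite gt_eqF.
Unshelve. all: by end_near. Qed.

Local Notation hf := (@hermite_function R).

Lemma is_cderive_hermite_function_real l x :
  is_cderive x 1 (fun x : R => hf l x%:C) (- hf l.+1 x%:C).
Proof.
have idx : is_cderive x 1 (fun x : R => x%:C) 1.
  by split => /=; [exact: is_derive_id|exact: is_derive_cst].
by move/is_cderive_eq: (is_cderive_hermite_function l idx); apply; rewrite mulr1.
Qed.

Lemma hermite_function_cdecaying_real l :
  exists C, cdecaying C (fun x => hf l x%:C).
Proof.
have [C] := hermite_function_cdecaying l (0 : R[i]).
by under eq_fun do rewrite addr0; exists C.
Qed.

Lemma cpv_mulx_hermite_function l :
  cpv (fun x => x%:C * hf l.+1 x%:C) = 0.
Proof.
have [C [Cr Ci]] := hermite_function_cdecaying_real l.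
have [C' [C'r C'i]] := hermite_function_cdecaying_real l.+1.
have C0 := decaying_ge0 Cr; have C'0 := decaying_ge0 C'r.
have half (P : R[i] -> R) : decaying C (fun x => P (hf l x%:C)) ->
    decaying C' (fun x => P (hf l.+1 x%:C)) ->
    (forall z, P (- z) = - P z) ->
    (forall x : R, is_derive x 1 (fun x : R => P (hf l x%:C)) (P (- hf l.+1 x%:C))) ->
    pv (fun x => x * P (hf l.+1 x%:C)) = 0.
  move=> d d' PN Pd.
  have d'' := decaying_lin (-1) d (decaying0 R).
  rewrite normrN1 mul1r addr0 in d''.
  apply: (@pv_mulx_derive (C + C') (fun x => -1 * P (hf l x%:C) + 0)).
  - by apply: decaying_le d''; rewrite lerDl.
  - move=> x; have := is_deriveD
      (is_deriveM (is_derive_cst (-1 : R) x 1) (Pd x)) (is_derive_cst (0 : R) x 1).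
    by move/is_derive_eq; apply; rewrite /GRing.scale /= /cst PN; ring.
  - by apply: decaying_le d'; rewrite lerDr.
apply: complexP; rewrite /cpv /=.
  under eq_fun do rewrite ReZ.
  exact: (half (@complex.Re R) Cr C'r (@ReN R)
    (fun x => (is_cderive_hermite_function_real l x).1)).
under eq_fun do rewrite ImZ.
exact: (half (@complex.Im R) Ci C'i (@ImN R)
  (fun x => (is_cderive_hermite_function_real l x).2)).
Qed.

(** Integrate the three-term recurrence against [1 / x]: the first term becomes
    the integral of a derivative of a decaying function, which is zero. *)
Lemma hermite_momentSS l :
  hermite_moment R l.+2 = - (2 * l.+1%:R) * hermite_moment R l.
Proof.
have [C cdec] := hermite_function_cdecaying_real l.
have [C1 cdec1] := hermite_function_cdecaying_real l.+2.
have lin := cdecaying_lin (2 * l.+1%:R) cdec cdec1.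
have E : (fun x : R => 2 * (x%:C * hf l.+1 x%:C) + 0) =
   (fun x : R => 2 * l.+1%:R * hf l x%:C + hf l.+2 x%:C).
  by apply/funext => x; rewrite hermite_functionSS; ring.
have lin2 := cdecaying_lin (2^-1) lin (cdecaying0 R).
have E2 : (fun x : R => x%:C * hf l.+1 x%:C) =
   (fun x : R => 2^-1 * (2 * l.+1%:R * hf l x%:C + hf l.+2 x%:C) + 0).
  by apply/funext => x; rewrite hermite_functionSS; field.
have := cpv_mulx_hermite_function l.
rewrite E2 (cpv_lin _ lin (cdecaying0 R)) cpv0 addr0 (cpv_lin _ cdec cdec1).
move/(congr1 (fun z => 2 * z)); rewrite mulr0 mulrA divff// mul1r addrC => /eqP.
by rewrite addr_eq0 => /eqP; rewrite mulNr.
Qed.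

Lemma cexp_real x : cexp (x%:C) = (expR x)%:C.
Proof. by rewrite /cexp /= cos0 sin0 mulr1 mulr0. Qed.

Lemma hermite_moment0 : hermite_moment R 0 = 0.
Proof.
have odd0 g : (forall x, g (- x) = g x) -> pv g = 0.
  move=> ge; rewrite /pv; under eq_Rintegral do rewrite /pv_integrand ge subrr mul0r.
  by rewrite Rintegral_cst// mul0r.
have even x : hf 0 (- x)%:C = hf 0 x%:C.
  by rewrite /hermite_function !hermite0 rmorphN sqrrN.
by apply: complexP; rewrite /= odd0// => x; rewrite even.
Qed.

(** Here the principal value reduces to the Gaussian integral. *)
Lemma hermite_moment1 : hermite_moment R 1 = (2 * Num.sqrt pi)%:C.
Proof.
have E x : hf 1 x%:C = (2 * x * gauss_fun x)%:C.
  rewrite /hermite_function hermite1 -rmorphXn -rmorphN cexp_real.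
  by rewrite -(rmorph_nat (real_complex R)) -!rmorphM /gauss_fun mulrC.
rewrite /hermite_moment /cpv; under eq_fun do rewrite E /=.
under [X in _ +i* pv X]eq_fun do rewrite E /=.
apply: complexP => /=; last first.
  by have := congr1 (@complex.Im R) (@cpv0 R).
have mg : measurable_fun setT (@gauss_fun R) := measurable_gauss_fun.
transitivity (\int[mu]_(x in (`]0%R, +oo[%classic : set R)) (4 * gauss_fun x)).
  apply: eq_Rintegral => x; rewrite inE/= in_itv/= andbT => x0.
  rewrite /pv_integrand (_ : gauss_fun (- x) = gauss_fun x).
    by field; rewrite gt_eqF.
  by rewrite /gauss_fun sqrrN.
have gi : mu.-integrable `[0%R, +oo[ (EFin \o gauss_fun).
  by apply: integrableS integrableT_gauss.
rewrite Rintegral_half_line; last first.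
  by apply/measurable_EFinP/measurable_funTS; exact: measurable_funM.
rewrite RintegralZl// /Rintegral integral0y_gauss /=.
by field.
Qed.

Lemma hermite_moment_even k : hermite_moment R k.*2 = 0.
Proof.
by elim: k => [|k IH]; rewrite ?hermite_moment0// doubleS hermite_momentSS IH mulr0.
Qed.

Lemma hermite_function_odd_at0 k : hf k.*2.+1 0 = 0.
Proof.
elim: k => [|k IH]; first by rewrite /hermite_function hermite1 !mulr0.
by rewrite doubleS hermite_functionSS IH !mulr0 mul0r subr0.
Qed.

Lemma hermite_functionSS_at0 l : hf l.+2 0 = - (2 * l.+1%:R) * hf l 0.
Proof. by rewrite hermite_functionSS mulr0 mul0r add0r mulNr. Qed.

End HermiteMoments.

(** * Wallis integrals *)

Section TrigonometricIntegrals.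
Variable R : realType.
Local Notation mu := (@lebesgue_measure R).

Definition wallis (a b : nat) : R :=
  \int[mu]_(t in `[0%R, (pi : R)]) (cos t ^+ a * sin t ^+ b).

Lemma continuous_expr (f : R -> R) n : continuous f ->
  continuous (fun t => f t ^+ n).
Proof.
move=> cf x; apply: (@continuous_comp _ _ _ f (fun y : R => y ^+ n)).
  exact: cf.
exact: exprn_continuous.
Qed.

Lemma continuous_integrable_0pi (f : R -> R) : continuous f ->
  mu.-integrable `[0, pi] (EFin \o f).
Proof.
move=> cf; apply: continuous_compact_integrable; first exact: segment_compact.
exact: continuous_subspaceT.
Qed.

Lemma continuous_trig a b : continuous (fun t : R => cos t ^+ a * sin t ^+ b).
Proof.
move=> x; apply: cvgM; apply: continuous_expr.
  exact: continuous_cos.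
exact: continuous_sin.
Qed.

Lemma Rintegral_derive_0pi (F f : R -> R) : continuous f ->
  (forall t : R, is_derive t 1 F (f t)) ->
  \int[mu]_(t in `[0%R, (pi : R)]) f t = F pi - F 0.
Proof.
move=> cf Fd; have cF := is_derive_continuous Fd.
rewrite /Rintegral (continuous_FTC2 (F := F)) ?pi_gt0//.
- exact: continuous_subspaceT.
- split; first by move=> x _; case: (Fd x).
    exact/cvg_at_right_filter/cF.
  exact/cvg_at_left_filter/cF.
- by move=> x _; rewrite derive1E; case: (Fd x).
Qed.

Lemma is_derive_cosX (n : nat) (t : R) :
  is_derive t 1 (fun t : R => cos t ^+ n.+1) (- (n.+1%:R * cos t ^+ n * sin t)).
Proof.
have := is_deriveX n.+1 (is_derive_cos t); rewrite exprfctE.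
by move/is_derive_eq; apply; rewrite /GRing.scale /= mulrN.
Qed.

Lemma is_derive_sinX (n : nat) (t : R) :
  is_derive t 1 (fun t : R => sin t ^+ n.+1) (n.+1%:R * sin t ^+ n * cos t).
Proof.
have := is_deriveX n.+1 (is_derive_sin t); rewrite exprfctE.
by move/is_derive_eq; apply; rewrite /GRing.scale.
Qed.

Lemma wallis1 b : wallis 1 b = 0.
Proof.
have Fd (t : R) : is_derive t 1 (fun t : R => b.+1%:R^-1 * sin t ^+ b.+1)
    (cos t ^+ 1 * sin t ^+ b).
  have := is_deriveM (is_derive_cst (b.+1%:R^-1 : R) t 1) (is_derive_sinX b t).
  move/is_derive_eq; apply; rewrite /GRing.scale /= /cst mulr0 addr0.
  by field; rewrite addrC natr1 pnatr_eq0.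
rewrite /wallis (Rintegral_derive_0pi _ Fd); last exact: continuous_trig.
by rewrite sinpi sin0 subrr.
Qed.

Lemma wallis_parts a b :
  a.+1%:R * wallis a b.+2 = b.+1%:R * wallis a.+2 b.
Proof.
have Fd (t : R) : is_derive t 1 (fun t : R => cos t ^+ a.+1 * sin t ^+ b.+1)
    (b.+1%:R * (cos t ^+ a.+2 * sin t ^+ b) - a.+1%:R * (cos t ^+ a * sin t ^+ b.+2)).
  have := is_deriveM (is_derive_cosX a t) (is_derive_sinX b t).
  by move/is_derive_eq; apply; rewrite /GRing.scale /= !exprS; ring.
have cZ (k : R) a' b' : continuous (fun t : R => k * (cos t ^+ a' * sin t ^+ b')).
  by move=> x; apply: cvgM; [exact: cvg_cst|exact: continuous_trig].
have mI : measurable (`[0, pi]%classic : set (measurableTypeR R)).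
  exact: measurable_itv.
have := Rintegral_derive_0pi _ Fd.
rewrite sinpi sin0 !expr0n /= !mulr0 subrr => /(_ _)/esym.
rewrite RintegralB//; [|exact/continuous_integrable_0pi..].
rewrite !RintegralZl//; [|exact/continuous_integrable_0pi/continuous_trig..].
move=> E; apply/eqP; rewrite eq_sym -subr_eq0; apply/eqP; rewrite E//.
by move=> x; apply: cvgB; exact: cZ.
Qed.

Lemma wallis_split a b : wallis a b = wallis a.+2 b + wallis a b.+2.
Proof.
have mI : measurable (`[0, pi]%classic : set (measurableTypeR R)).
  exact: measurable_itv.
rewrite /wallis -RintegralD//; [|exact/continuous_integrable_0pi/continuous_trig..].
apply: eq_Rintegral => t _.
rewrite -[LHS]mulr1 -(cos2Dsin2 t) !exprS; ring.
Qed.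

(** Eliminate [wallis a b.+2] between integration by parts and the identity
    [cos ^ 2 + sin ^ 2 = 1]. *)
Lemma wallisSS a b :
  wallis a.+2 b = a.+1%:R / (a + b).+2%:R * wallis a b.
Proof.
have E := wallis_parts a b; rewrite (wallis_split a b).
have n0 n : n.+1%:R != 0 :> R by rewrite pnatr_eq0.
have -> : wallis a b.+2 = b.+1%:R / a.+1%:R * wallis a.+2 b.
  by rewrite mulrAC -E; field; rewrite addrC natr1 n0.
have -> : (a + b).+2%:R = a.+1%:R + b.+1%:R :> R by rewrite -natrD addSn addnS.
have AB : a.+1%:R + b.+1%:R != 0 :> R by rewrite -natrD addSn n0.
by move: (n0 a) AB; move: a.+1%:R b.+1%:R => A B A0 AB; field; rewrite A0 AB.
Qed.

Lemma wallis_odd a b : odd a -> wallis a b = 0.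
Proof.
move=> oa; rewrite -(odd_double_half a) oa add1n.
by elim: a./2 => [|k IH]; rewrite ?wallis1// doubleS wallisSS IH mulr0.
Qed.

Lemma wallis00 : wallis 0 0 = pi.
Proof.
rewrite /wallis; under eq_Rintegral do rewrite !expr0 mulr1.
have mu_pi : mu (`[0, pi]%classic : set (measurableTypeR R)) = (pi : R)%:E.
  by rewrite lebesgue_measure_itv/= lte_fin pi_gt0 -EFinB subr0.
by rewrite Rintegral_cst// [X in fine X]mu_pi mul1r.
Qed.

Lemma wallis01 : wallis 0 1 = 2.
Proof.
have Fd (t : R) : is_derive t 1 (fun t : R => - cos t) (cos t ^+ 0 * sin t ^+ 1).
  have := is_deriveN (is_derive_cos t).
  by move/is_derive_eq; apply; rewrite expr0 mul1r opprK.
rewrite /wallis (Rintegral_derive_0pi _ Fd); last exact: continuous_trig.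
by rewrite cospi cos0 !opprK.
Qed.

Lemma wallis0SS b : wallis 0 b.+2 = b.+1%:R / b.+2%:R * wallis 0 b.
Proof.
have := wallis_parts 0 b; rewrite mul1r => ->.
rewrite wallisSS add0n mul1r.
by field; rewrite -natrD pnatr_eq0.
Qed.

Lemma wallis_consecutive b : wallis 0 b * wallis 0 b.+1 = 2 * pi / b.+1%:R.
Proof.
elim: b => [|b IH]; first by rewrite wallis00 wallis01 divr1 mulrC.
rewrite wallis0SS mulrCA [wallis 0 b.+1 * _]mulrC IH.
have n0 n : n.+1%:R != 0 :> R by rewrite pnatr_eq0.
by move: (n0 b) (n0 b.+1); move: b.+1%:R b.+2%:R => B B' B0 B'0; field; rewrite B0 B'0.
Qed.

End TrigonometricIntegrals.

(** * Integration over the sphere *)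

Section SphereIntegral.
Variable R : realType.
Local Notation mu := (@lebesgue_measure R).
Local Notation I0pi := [set` `[0%R, (pi : R)]].

Definition ccontinuous (f : R -> R[i]) : Prop :=
  continuous (fun t => Re (f t)) /\ continuous (fun t => Im (f t)).

Lemma ccontinuous_cst a : ccontinuous (fun=> a).
Proof. by split=> x; exact: cvg_cst. Qed.

Lemma ccontinuousD f g : ccontinuous f -> ccontinuous g ->
  ccontinuous (fun t => f t + g t).
Proof.
move=> [fr fi] [gr gi]; split=> x.
  by under eq_fun do rewrite ReD; apply: cvgD; [exact: fr|exact: gr].
by under eq_fun do rewrite ImD; apply: cvgD; [exact: fi|exact: gi].
Qed.

Lemma ccontinuousM f g : ccontinuous f -> ccontinuous g ->
  ccontinuous (fun t => f t * g t).
Proof.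
move=> [fr fi] [gr gi]; split=> x.
  under eq_fun do rewrite ReM.
  by apply: cvgB; apply: cvgM; [exact: fr|exact: gr|exact: fi|exact: gi].
under eq_fun do rewrite ImM.
by apply: cvgD; apply: cvgM; [exact: fr|exact: gi|exact: fi|exact: gr].
Qed.

Lemma ccontinuous_real (f : R -> R) : continuous f -> ccontinuous (fun t => (f t)%:C).
Proof. by move=> cf; split=> //= x; exact: cvg_cst. Qed.

Lemma ccontinuous_sum N (f : nat -> R -> R[i]) : (forall m, ccontinuous (f m)) ->
  ccontinuous (fun t => \sum_(m < N) f m t).
Proof.
move=> cf; elim: N => [|N IH].
  have -> : (fun t => \sum_(m < 0) f m t) = (fun=> 0).
    by apply/funext => t; rewrite big_ord0.
  exact: ccontinuous_cst.
have -> : (fun t => \sum_(m < N.+1) f m t) = (fun t => \sum_(m < N) f m t + f N t).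
  by apply/funext => t; rewrite big_ord_recr.
exact: ccontinuousD.
Qed.

Lemma continuous_uniform_limit (F : R -> R) :
  (forall eps, 0 < eps -> exists2 f : R -> R, continuous f &
     forall t, `|F t - f t| <= eps) -> continuous F.
Proof.
move=> H x; apply/cvgrPdist_le => /= eps eps0.
have [|f cf Ff] := H (eps / 3); first by rewrite divr_gt0.
have := cf x => /cvgrPdist_le /(_ (eps / 3)); rewrite divr_gt0// => /(_ isT).
apply: filterS => y fxy.
rewrite (_ : F x - F y = (F x - f x) + (f x - f y) - (F y - f y)); last by ring.
apply: le_trans (ler_normB _ _) _.
apply: le_trans (lerD (ler_normD _ _) (lexx _)) _.
by have := Ff x; have := Ff y; move: fxy; lra.
Qed.

Lemma ccontinuous_uniform_limit (F : R -> R[i]) :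
  (forall eps, 0 < eps -> exists2 f, ccontinuous f &
     forall t, norm1 (F t - f t) <= eps) -> ccontinuous F.
Proof.
move=> H; split; apply: continuous_uniform_limit => eps /H [f [fr fi] Ff].
  exists (fun t => Re (f t)) => // t; apply: le_trans (Ff t).
  by rewrite -ReB; exact: Re_le_norm1.
exists (fun t => Im (f t)) => // t; apply: le_trans (Ff t).
by rewrite -ImB; exact: Im_le_norm1.
Qed.

Lemma cintegral_lin a f g : ccontinuous f -> ccontinuous g ->
  cintegral I0pi (fun t => a * f t + g t) =
  a * cintegral I0pi f + cintegral I0pi g.
Proof.
move=> [fr fi] [gr gi].
have mI : measurable (`[0, pi]%classic : set (measurableTypeR R)).
  exact: measurable_itv.
have cZ k (h : R -> R) : continuous h -> continuous (fun t => k * h t).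
  by move=> ch x; apply: cvgM; [exact: cvg_cst|exact: ch].
have cD (h k : R -> R) : continuous h -> continuous k ->
    continuous (fun t => h t + k t).
  by move=> ch ck x; apply: cvgD; [exact: ch|exact: ck].
have lin (p q r : R -> R) (k k' : R) : continuous p -> continuous q -> continuous r ->
    \int[mu]_(t in I0pi) (k * p t + (k' * q t + r t)) =
    k * \int[mu]_(t in I0pi) p t +
      (k' * \int[mu]_(t in I0pi) q t + \int[mu]_(t in I0pi) r t).
  move=> cp cq cr.
  rewrite RintegralD//; [|apply: continuous_integrable_0pi..]; last 2 first.
  - exact: cZ.
  - by apply: cD => //; exact: cZ.
  rewrite RintegralD//; [|apply: continuous_integrable_0pi..] => //; last exact: cZ.
  by rewrite !RintegralZl//; exact: continuous_integrable_0pi.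
apply: complexP; rewrite ?ReD ?ImD ?ReM ?ImM /cintegral /=.
  rewrite -[RHS](_ : Re a * (\int[mu]_(t in I0pi) Re (f t)) +
    (- Im a * (\int[mu]_(t in I0pi) Im (f t)) + \int[mu]_(t in I0pi) Re (g t)) = _);
    last by ring.
  by rewrite -lin//; apply: eq_Rintegral => t _; rewrite ReD ReM; ring.
rewrite -[RHS](_ : Re a * (\int[mu]_(t in I0pi) Im (f t)) +
  (Im a * (\int[mu]_(t in I0pi) Re (f t)) + \int[mu]_(t in I0pi) Im (g t)) = _);
  last by ring.
by rewrite -lin//; apply: eq_Rintegral => t _; rewrite ImD ImM; ring.
Qed.

Lemma cintegral0 : cintegral I0pi (fun=> 0 : R[i]) = 0.
Proof. by apply: complexP; rewrite /= Rintegral_cst// mul0r. Qed.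

Lemma cintegral_sum N (a : nat -> R[i]) (f : nat -> R -> R[i]) :
  (forall m, ccontinuous (f m)) ->
  cintegral I0pi (fun t => \sum_(m < N) a m * f m t) =
  \sum_(m < N) a m * cintegral I0pi (f m).
Proof.
move=> cf; elim: N => [|N IH].
  have -> : (fun t => \sum_(m < 0) a m * f m t) = (fun=> 0).
    by apply/funext => t; rewrite big_ord0.
  by rewrite big_ord0 cintegral0.
have -> : (fun t => \sum_(m < N.+1) a m * f m t) =
    (fun t => a N * f N t + \sum_(m < N) a m * f m t).
  by apply/funext => t; rewrite big_ord_recr addrC.
rewrite cintegral_lin// ?IH ?big_ord_recr 1?addrC//.
apply: (@ccontinuous_sum N (fun m t => a m * f m t)) => m.
exact: ccontinuousM (ccontinuous_cst (a m)) (cf m).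
Qed.

Lemma cintegral_le f M : ccontinuous f ->
  (forall t, norm1 (f t) <= M) -> norm1 (cintegral I0pi f) <= 2 * pi * M.
Proof.
move=> [fr fi] fM.
have mI : measurable (`[0, pi]%classic : set (measurableTypeR R)).
  exact: measurable_itv.
have mu_pi : mu (`[0, pi]%classic : set (measurableTypeR R)) = (pi : R)%:E.
  by rewrite lebesgue_measure_itv/= lte_fin pi_gt0 -EFinB subr0.
have half (h : R -> R) : continuous h -> (forall t, `|h t| <= M) ->
    `|\int[mu]_(t in I0pi) h t| <= pi * M.
  move=> ch hM; have hi := continuous_integrable_0pi ch.
  apply: le_trans (le_normr_Rintegral mI hi) _.
  apply: (@le_trans _ _ (\int[mu]_(t in I0pi) M)).
    apply: le_Rintegral => //; first exact: integrable_norm hi.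
    by apply: continuous_integrable_0pi => x; exact: cvg_cst.
  by rewrite Rintegral_cst// [X in fine X]mu_pi mulrC.
rewrite /norm1 /= -mulrA [leRHS](_ : _ = pi * M + pi * M); last by ring.
apply: lerD; apply: half => // t; apply: le_trans (fM t).
  exact: Re_le_norm1.
exact: Im_le_norm1.
Qed.

Definition slice e (g : 'rV[R]_e.+2 -> R[i]) (t : R) : 'rV[R]_e.+1 -> R[i] :=
  fun v => g (row_mx ((cos t)%:M : 'rV[R]_1) (sin t *: v)).

(** The functions for which every integral in the iterated definition of
    [sphere_integral_rec] is that of a continuous function. *)
Fixpoint sphere_continuous (d : nat) : ('rV[R]_d.+1 -> R[i]) -> Prop :=
  match d return ('rV[R]_d.+1 -> R[i]) -> Prop with
  | 0 => fun _ => True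
  | e.+1 => fun g => (forall t, sphere_continuous (slice g t)) /\
      ccontinuous (fun t => sphere_integral_rec (slice g t))
  end.

Lemma sphere_lin d a f g : @sphere_continuous d f -> sphere_continuous g ->
  sphere_continuous (fun w => a * f w + g w) /\
  sphere_integral_rec (fun w => a * f w + g w) =
    a * sphere_integral_rec f + sphere_integral_rec g.
Proof.
elim: d a f g => [|e IH] a f g /=.
  by move=> _ _; split=> //; ring.
move=> [fs fc] [gs gc].
have sE t := IH a _ _ (fs t) (gs t).
have E : (fun t => sphere_integral_rec (slice (fun w => a * f w + g w) t)) =
    (fun t => a * sphere_integral_rec (slice f t) + sphere_integral_rec (slice g t)).
  by apply/funext => t; exact: (sE t).2.
split.
  split=> [t|]; first exact: (sE t).1.
  by rewrite E; apply: ccontinuousD gc; exact: ccontinuousM (ccontinuous_cst a) fc.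
have sX : ccontinuous (fun t => (sin t ^+ e)%:C).
  by apply: ccontinuous_real; exact/continuous_expr/continuous_sin.
rewrite -cintegral_lin; [|exact: ccontinuousM sX fc|exact: ccontinuousM sX gc].
congr cintegral; apply/funext => t; rewrite -/(slice _ t).
by rewrite (congr1 (@^~ t) E); rewrite -/(slice f t) -/(slice g t); ring.
Qed.

Lemma dot_slice e (a : R) (s : R) (v : 'rV[R]_e.+1) :
  dot (row_mx (a%:M : 'rV[R]_1) (s *: v)) (row_mx (a%:M : 'rV[R]_1) (s *: v)) =
  a ^+ 2 + s ^+ 2 * dot v v.
Proof.
rewrite /dot big_split_ord /= big_ord1 !row_mxEl !mxE eqxx !mulr1n mulr_sumr.
congr (_ + _).
by apply: eq_bigr => i _; rewrite !row_mxEr !mxE; ring.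
Qed.

Lemma unit_slice e (t : R) (v : 'rV[R]_e.+1) : dot v v = 1 ->
  dot (row_mx ((cos t)%:M : 'rV[R]_1) (sin t *: v))
      (row_mx ((cos t)%:M : 'rV[R]_1) (sin t *: v)) = 1.
Proof. by move=> v1; rewrite dot_slice v1 mulr1 cos2Dsin2. Qed.

Fixpoint sphere_bound (d : nat) : R :=
  if d is e.+1 then 2 * pi * sphere_bound e else 2.

Lemma sphere_bound_gt0 d : 0 < sphere_bound d.
Proof. by elim: d => //= d IH; rewrite !mulr_gt0// pi_gt0. Qed.

Lemma sphere_le d g M : @sphere_continuous d g ->
  (forall w, dot w w = 1 -> norm1 (g w) <= M) ->
  norm1 (sphere_integral_rec g) <= sphere_bound d * M.
Proof.
elim: d g => [|e IH] g /=.
  move=> _ gM; apply: le_trans (norm1D _ _) _.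
  have dot1 (a : R) : a * a = 1 -> norm1 (g a%:M) <= M.
    by move=> a1; apply: gM; rewrite /dot big_ord1 !mxE eqxx.
  have h1 := dot1 1 (mulr1 1); have := dot1 (-1) _; rewrite mulrNN mulr1.
  rewrite raddfN => /(_ erefl) h2.
  by rewrite mulr_natl mulr2n lerD.
move=> [gs gc] gM; have sX : ccontinuous (fun t => (sin t ^+ e)%:C).
  by apply: ccontinuous_real; exact/continuous_expr/continuous_sin.
rewrite -mulrA; apply: cintegral_le; first exact: ccontinuousM sX gc.
move=> t; rewrite norm1Z normrX.
apply: le_trans (IH _ (gs t) _); last by move=> v /unit_slice/gM; exact.
by rewrite ler_piMl ?norm1_ge0// exprn_ile1// ler_norml sin_geN1 sin_le1.
Qed.

(** At each level the inner integral is a uniform limit of continuous functions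
    of the latitude, because integration over the lower sphere is bounded for
    the supremum norm. *)
Lemma sphere_uniform_limit d g :
  (forall eps, 0 < eps -> exists2 f, @sphere_continuous d f &
     forall w, dot w w = 1 -> norm1 (g w - f w) <= eps) ->
  sphere_continuous g.
Proof.
elim: d g => [//|e IH] g gf /=.
have gs t : sphere_continuous (slice g t).
  apply: IH => eps /gf [f [fs fc] fg]; exists (slice f t); first exact: fs.
  move=> v /(unit_slice t).
  exact: fg.
split=> //; apply: ccontinuous_uniform_limit => eps eps0.
have [|f [fs fc] fg] := gf (eps / sphere_bound e).
  by rewrite divr_gt0// sphere_bound_gt0.
exists (fun t => sphere_integral_rec (slice f t)) => // t.
have [sc E] := sphere_lin (-1) (fs t) (gs t).
rewrite addrC -mulN1r -E.
apply: (@le_trans _ _ (sphere_bound e * (eps / sphere_bound e))).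
  apply: sphere_le => // v /(unit_slice t) v1.
  by rewrite mulN1r addrC; exact: fg.
by rewrite mulrC divfK// gt_eqF// sphere_bound_gt0.
Qed.

Lemma sphere0 d : sphere_continuous (fun _ : 'rV[R]_d.+1 => 0) /\
  sphere_integral_rec (fun _ : 'rV[R]_d.+1 => 0) = 0.
Proof.
elim: d => [|e [IH1 IH2]] /=; first by rewrite addr0.
have E : (fun t => sphere_integral_rec (slice (fun _ : 'rV[R]_e.+2 => 0) t)) =
    (fun=> 0).
  by apply/funext => t.
split; first by split=> //; rewrite E; exact: ccontinuous_cst.
rewrite -[RHS]cintegral0; congr cintegral; apply/funext => t.
by rewrite IH2 mulr0.
Qed.

Lemma sphere_sum d N (a : nat -> R[i]) (f : nat -> 'rV[R]_d.+1 -> R[i]) :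
  (forall m, sphere_continuous (f m)) ->
  sphere_continuous (fun w => \sum_(m < N) a m * f m w) /\
  sphere_integral_rec (fun w => \sum_(m < N) a m * f m w) =
  \sum_(m < N) a m * sphere_integral_rec (f m).
Proof.
move=> cf; elim: N => [|N [IH1 IH2]].
  have -> : (fun w => \sum_(m < 0) a m * f m w) = (fun=> 0).
    by apply/funext => w; rewrite big_ord0.
  by rewrite big_ord0; exact: sphere0.
have -> : (fun w => \sum_(m < N.+1) a m * f m w) =
    (fun w => a N * f N w + \sum_(m < N) a m * f m w).
  by apply/funext => w; rewrite big_ord_recr addrC.
have [H1 H2] := sphere_lin (a N) (cf N) IH1.
by split=> //; rewrite H2 IH2 big_ord_recr addrC.
Qed.

End SphereIntegral.

(** * Moments of linear forms on the sphere *)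

Section SphereMoments.
Variable R : realType.
Local Notation mu := (@lebesgue_measure R).
Local Notation I0pi := [set` `[0%R, (pi : R)]].

Fixpoint sphere_area (d : nat) : R :=
  if d is e.+1 then sphere_area e * wallis R 0 e else 2.

(** The integral over the sphere of dimension [d] of the power [2 p] of one
    coordinate. *)
Definition sphere_coef (d p : nat) : R :=
  if d is e.+1 then sphere_area e * wallis R p.*2 e else 2.

Lemma sphere_coef0 d : sphere_coef d 0 = sphere_area d.
Proof. by case: d. Qed.

Lemma sphere_coef_rec d p :
  sphere_coef d p.+1 = p.*2.+1%:R / (d + p.*2).+1%:R * sphere_coef d p.
Proof.
have n0 n : n.+1%:R != 0 :> R by rewrite pnatr_eq0.
case: d => [|e]; first by rewrite /= divff// mul1r.
rewrite /sphere_coef doubleS wallisSS mulrCA; congr (_ / _%:R * _).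
by rewrite addnC addSn.
Qed.

(** The coefficient identity behind the rotation invariance of the moments:
    passing from [i] to [i + 1] at fixed [i + q], the ratios of the binomial coefficients, of
    [sphere_coef] and of [wallis] multiply to the ratio of ['C(i + q, i)]. *)
Lemma sphere_coef_bin e i q :
  'C((i + q).*2, i.*2)%:R * sphere_coef e i * wallis R q.*2 (e + i.*2) =
  'C(i + q, i)%:R * sphere_coef e.+1 (i + q).
Proof.
elim: i q => [|i IH] q; first by rewrite !bin0 !mul1r addn0 sphere_coef0.
have n0 n : n.+1%:R != 0 :> R by rewrite pnatr_eq0.
have {IH} := IH q.+1; rewrite addnS -addSn => IH.
have B1 : i.+1%:R * 'C(i.+1 + q, i.+1)%:R = q.+1%:R * 'C(i.+1 + q, i)%:R :> R.
  by rewrite -!natrM mul_bin_left addSnnS addKn.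
have B2 : i.*2.+1%:R * i.*2.+2%:R * 'C((i.+1 + q).*2, i.+1.*2)%:R =
    q.*2.+1%:R * q.*2.+2%:R * 'C((i.+1 + q).*2, i.*2)%:R :> R.
  have b1 := congr1 (fun k => k%:R : R) (mul_bin_left (i.+1 + q).*2 i.*2).
  have b2 := congr1 (fun k => k%:R : R) (mul_bin_left (i.+1 + q).*2 i.*2.+1).
  have k1 : ((i.+1 + q).*2 - i.*2 = q.*2.+2)%N by lia.
  have k2 : ((i.+1 + q).*2 - i.*2.+1 = q.*2.+1)%N by lia.
  rewrite /= k1 !natrM in b1; rewrite /= k2 !natrM in b2.
  by rewrite doubleS -mulrA b2 mulrCA b1 mulrA.
have W := wallis_parts R q.*2 (e + i.*2).
rewrite doubleS in IH.
rewrite sphere_coef_rec [(i.+1).*2]doubleS !addnS.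
have dE n : (n.*2.+2)%:R = 2 * n.+1%:R :> R by rewrite -doubleS -muln2 natrM mulrC.
rewrite !dE in B2.
have E1 : 'C((i.+1 + q).*2, i.*2.+2)%:R =
   q.*2.+1%:R * q.+1%:R / (i.*2.+1%:R * i.+1%:R) * 'C((i.+1 + q).*2, i.*2)%:R :> R.
  apply: (@mulfI _ (i.*2.+1%:R * (2 * i.+1%:R))).
    by rewrite !mulf_neq0// pnatr_eq0.
  rewrite B2; move: (n0 i.*2) (n0 i); move: i.*2.+1%:R i.+1%:R => x y x0 y0.
  by field; rewrite x0 y0.
have E2 : wallis R q.*2 (e + i.*2).+2 =
    (e + i.*2).+1%:R / q.*2.+1%:R * wallis R q.*2.+2 (e + i.*2).
  by rewrite mulrAC -W; field; rewrite addrC natr1 n0.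
have E3 : 'C(i.+1 + q, i.+1)%:R = q.+1%:R / i.+1%:R * 'C(i.+1 + q, i)%:R :> R.
  by rewrite mulrAC -B1; field; rewrite addrC natr1 n0.
rewrite E1 E2 E3 -[RHS]mulrA -IH.
move: (n0 i.*2) (n0 i) (n0 (e + i.*2)%N) (n0 q.*2).
move: i.*2.+1%:R i.+1%:R (e + i.*2).+1%:R q.*2.+1%:R => x y z t x0 y0 z0 t0.
by field; rewrite x0 y0 z0 t0.
Qed.

Lemma cintegral_real (f : R -> R) :
  cintegral I0pi (fun t => (f t)%:C) = (\int[mu]_(t in I0pi) f t)%:C.
Proof. by rewrite /cintegral /= Rintegral_cst// mul0r. Qed.

Lemma sum_even (V : nmodType) (F : nat -> V) p :
  (forall j, odd j -> F j = 0) ->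
  \sum_(j < p.*2.+1) F j = \sum_(i < p.+1) F i.*2.
Proof.
move=> F0; elim: p => [|p IH]; first by rewrite !big_ord1.
rewrite doubleS 2!big_ord_recr IH [RHS]big_ord_recr /=.
by rewrite (F0 p.*2.+1) ?addr0//= odd_double.
Qed.

Lemma dot_row_mx e (a : R[i]) (c s : R) (z : 'rV[R[i]]_e.+1) (v : 'rV[R]_e.+1) :
  dot (row_mx (a%:M : 'rV_1) z) (toC (row_mx (c%:M : 'rV_1) (s *: v))) =
  a * c%:C + s%:C * dot z (toC v).
Proof.
rewrite /dot big_split_ord /= big_ord1 /toC map_row_mx !row_mxEl !mxE eqxx !mulr1n.
congr (_ + _); rewrite mulr_sumr; apply: eq_bigr => i _.
by rewrite !row_mxEr !mxE rmorphM /=; ring.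
Qed.

Lemma dot_row_mx_sqr e (a : R[i]) (z : 'rV[R[i]]_e.+1) :
  dot (row_mx (a%:M : 'rV_1) z) (row_mx (a%:M : 'rV_1) z) = a ^+ 2 + dot z z.
Proof.
rewrite /dot big_split_ord /= big_ord1 !row_mxEl !mxE eqxx !mulr1n expr2.
by congr (_ + _); apply: eq_bigr => i _; rewrite !row_mxEr.
Qed.

Definition sphere_moment d m (z : 'rV[R[i]]_d.+1) : R[i] :=
  if odd m then 0 else (sphere_coef d m./2)%:C * dot z z ^+ m./2.

(** Split off the first coordinate and expand by the binomial theorem; after
    integration only even powers of the remaining coordinates survive, and
    [sphere_coef_bin] recombines them into a power of [dot z z]. *)
Lemma sphere_power d m (z : 'rV[R[i]]_d.+1) :
  sphere_continuous (fun w => dot z (toC w) ^+ m) /\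
  sphere_integral_rec (fun w => dot z (toC w) ^+ m) = sphere_moment m z.
Proof.
elim: d m z => [|e IH] m z.
  split=> //=; rewrite /sphere_moment /dot !big_ord1 !mxE eqxx !mulr1n.
  rewrite rmorphN rmorph1 mulr1 mulrN1 exprNn -signr_odd.
  case: (boolP (odd m)) => om /=; first by rewrite expr1 mulN1r subrr.
  rewrite expr0 mul1r -expr2 -exprM mul2n.
  by rewrite -[m in LHS]odd_double_half (negbTE om) rmorph_nat mulr_natl mulr2n.
have [a [z' zE]] : exists a z', z = row_mx (a%:M : 'rV_1) z'.
  exists (lsubmx (z : 'rV_(1 + e.+1)) 0 0), (rsubmx (z : 'rV_(1 + e.+1))).
  by rewrite -mx11_scalar hsubmxK.
rewrite {z}zE; set g := fun w => _ ^+ m.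
pose coef j (t : R) : R[i] := (a * (cos t)%:C) ^+ (m - j) * (sin t)%:C ^+ j *+ 'C(m, j).
have sE t : slice g t = (fun v => \sum_(j < m.+1) coef j t * dot z' (toC v) ^+ j).
  apply/funext => v; rewrite /slice /g dot_row_mx exprDn.
  apply: eq_bigr => j _; rewrite /coef [(_ * dot _ _) ^+ _]exprMn mulrnAl.
  by rewrite mulrA.
have sI t := sphere_sum m.+1 (fun j => coef j t) (fun j => (IH j z').1).
have inner t : sphere_integral_rec (slice g t) =
    \sum_(j < m.+1) coef j t * sphere_moment j z'.
  by rewrite sE (sI t).2; apply: eq_bigr => j _; rewrite (IH j z').2.
have trigC k j : ccontinuous (fun t => (cos t ^+ k * sin t ^+ j)%:C : R[i]).
  exact/ccontinuous_real/continuous_trig.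
have coefE j t : coef j t =
    'C(m, j)%:R * a ^+ (m - j) * (cos t ^+ (m - j) * sin t ^+ j)%:C.
  rewrite /coef exprMn -mulr_natl rmorphM !rmorphXn /=; ring.
split.
  split=> [t|]; first by rewrite sE; exact: (sI t).1.
  have -> : (fun t => sphere_integral_rec (slice g t)) =
      (fun t => \sum_(j < m.+1) coef j t * sphere_moment j z') by apply/funext.
  apply: (@ccontinuous_sum R m.+1 (fun j t => coef j t * sphere_moment j z')) => j.
  apply: ccontinuousM (ccontinuous_cst _); rewrite (funext (coefE j)).
  exact: ccontinuousM (ccontinuous_cst _) (trigC _ _).
have -> : sphere_integral_rec g = cintegral I0pi (fun t => \sum_(j < m.+1)
    ('C(m, j)%:R * a ^+ (m - j) * sphere_moment j z') *
    (cos t ^+ (m - j) * sin t ^+ (e + j))%:C).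
  transitivity (cintegral I0pi
    (fun t => (sin t ^+ e)%:C * sphere_integral_rec (slice g t))) => //.
  congr cintegral; apply/funext => t; rewrite inner mulr_sumr; apply: eq_bigr => j _.
  by rewrite coefE exprD !rmorphM /=; ring.
rewrite (@cintegral_sum R m.+1
  (fun j => 'C(m, j)%:R * a ^+ (m - j) * sphere_moment j z')
  (fun j t => (cos t ^+ (m - j) * sin t ^+ (e + j))%:C)) => [|j]; last exact: trigC.
under eq_bigr do rewrite cintegral_real -/(wallis R _ _).
rewrite [RHS]/sphere_moment; case: ifPn => om.
  rewrite big1// => j _; rewrite /sphere_moment; case: ifPn => oj.
    by rewrite mulr0 mul0r.
  rewrite wallis_odd ?mulr0//= oddB ?om ?(negbTE oj)//.
  by rewrite -ltnS.
have mE : m = (m./2).*2 by rewrite -[LHS]odd_double_half (negbTE om).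
move: (m./2) mE => p mE; rewrite mE.
rewrite (@sum_even _ (fun j => 'C(p.*2, j)%:R * a ^+ (p.*2 - j) * sphere_moment j z' *
  (wallis R (p.*2 - j) (e + j))%:C)); last first.
  by move=> j oj; rewrite /sphere_moment oj mulr0 mul0r.
rewrite dot_row_mx_sqr exprDn mulr_sumr; apply: eq_bigr => i _.
set q := (p - i)%N.
have qE : (i + q)%N = p by rewrite subnKC// -ltnS.
have qE2 : (p.*2 - i.*2)%N = q.*2 by rewrite -doubleB.
have := congr1 (real_complex R) (sphere_coef_bin e i q).
rewrite qE; move: (sphere_coef e.+1 p) => sigma; rewrite !rmorphM !rmorph_nat => cE.
rewrite /sphere_moment odd_double doubleK qE2 -mulr_natl -exprM mul2n.
transitivity ('C(p.*2, i.*2)%:R * (sphere_coef e i)%:C * (wallis R q.*2 (e + i.*2))%:C *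
  (a ^+ q.*2 * dot z' z' ^+ i)); first by ring.
by rewrite cE /=; ring.
Qed.

End SphereMoments.

(** * Spherical means of entire functions *)

Section SphereMeans.
Variable R : realType.

Lemma le0_geometric (X A : R) : (forall N, X <= A / 2 ^+ N) -> X <= 0.
Proof.
move=> XA; rewrite leNgt; apply/negP => X0.
have A0 : 0 <= A by have := XA 0%N; rewrite expr0 divr1; exact/le_trans/ltW.
have [N AN] : exists N : nat, A / X < N%:R.
  by exists (Num.bound (A / X)); apply: archi_boundP; rewrite divr_ge0// ltW.
have := XA N; rewrite ler_pdivlMr ?exprn_gt0// -ler_pdivlMl//.
apply/negP; rewrite -ltNge mulrC; apply: lt_trans AN _.
by rewrite -natrX ltr_nat ltn_expl.
Qed.

Lemma geometric_le (A eps : R) : 0 < eps -> exists N, A / 2 ^+ N <= eps.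
Proof.
move=> eps0; apply: contrapT => /forallNP H.
suff : eps <= 0 by rewrite leNgt eps0.
by apply: (@le0_geometric _ A) => N; move/negP: (H N); rewrite -ltNge => /ltW.
Qed.

(** The recursion of the numbers [f m] for which the sum of
    [(- c) ^+ m / m`! * f m] is a multiple of Kummer's function
    1F1 (n / 2; 1 / 2; - c ^ 2); it is the Gaussian for [n = 1]. *)
Definition kummer_coef (n : nat) (f : nat -> R[i]) : Prop :=
  f 1 = 0 /\ forall m, f m.+2 = - (2 * (n + m)%:R) * f m.

(** [F] is entire with Taylor coefficients [(-1) ^+ m / m`! * f m]: the partial
    sums converge geometrically on every disc. *)
Definition entire_with (F : R[i] -> R[i]) (f : nat -> R[i]) : Prop :=
  forall M : R, 1 <= M -> exists2 K : R, 0 <= K & forall N c, norm1 c <= M ->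
    norm1 (F c - \sum_(m < N) (- c) ^+ m / (m`!)%:R * f m) <= K / 2 ^+ N.

Lemma kummer_coef_odd n f m : kummer_coef n f -> odd m -> f m = 0.
Proof.
move=> [f1 fS]; rewrite -[in f m](odd_double_half m) => ->; rewrite add1n.
by elim: m./2 => [//|k IH]; rewrite doubleS fS IH mulr0.
Qed.

(** The factor [d + 1 + 2 i] of the Kummer recursion cancels the denominator of
    [sphere_coef_rec], and the exponential series remains. *)
Lemma kummer_coef_even d f i : kummer_coef d.+1 f ->
  f i.*2 / (i.*2`!)%:R * (sphere_coef R d i)%:C =
  f 0 * (sphere_area R d)%:C * ((-1) ^+ i / (i`!)%:R).
Proof.
move=> [_ fS]; elim: i => [|i IH].
  by rewrite sphere_coef0 expr0 !fact0 !divr1 mulr1.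
have n0 n : n.+1%:R != 0 :> R[i] by rewrite pnatr_eq0.
have f0 n : (n`!)%:R != 0 :> R[i] by rewrite pnatr_eq0 -lt0n fact_gt0.
rewrite doubleS fS sphere_coef_rec !factS !natrM exprS mulN1r.
rewrite rmorphM fmorph_div !rmorph_nat addSn.
have -> : i.*2.+2%:R = 2 * i.+1%:R :> R[i] by rewrite -doubleS -muln2 natrM mulrC.
rewrite -[RHS](_ : - (i.+1%:R^-1) *
  (f 0 * (sphere_area R d)%:C * ((-1) ^+ i / (i`!)%:R)) = _).
  rewrite -IH; move: (n0 i) (n0 i.*2) (n0 (d + i.*2)%N) (f0 i.*2) => /=.
  move: i.+1%:R i.*2.+1%:R (d + i.*2).+1%:R (i.*2`!)%:R => x y z t x0 y0 z0 t0.
  by field; rewrite x0 y0 z0 t0.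
by field; rewrite f0 addrC natr1 n0.
Qed.

Lemma kummer_partial_sum d f p (z : 'rV[R[i]]_d.+1) : kummer_coef d.+1 f ->
  \sum_(m < p.*2.+1) ((-1) ^+ m / (m`!)%:R * f m) * sphere_moment m z =
  f 0 * (sphere_area R d)%:C * \sum_(i < p.+1) (- dot z z) ^+ i / (i`!)%:R.
Proof.
move=> fk; rewrite (@sum_even _
  (fun m => ((-1) ^+ m / (m`!)%:R * f m) * sphere_moment m z)).
  rewrite mulr_sumr; apply: eq_bigr => i _.
  rewrite -signr_odd odd_double expr0 div1r /sphere_moment odd_double doubleK.
  rewrite [(- _) ^+ i]exprNn mulrA [_^-1 * f _]mulrC kummer_coef_even//.
  by ring.
by move=> j oj; rewrite (kummer_coef_odd fk oj) mulr0 mul0r.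
Qed.

(** The exponential series with a geometric remainder, read off the expansion
    of the Gaussian at a square root of [q]. *)
Lemma entire_with_gauss (q : R[i]) :
  exists2 K : R, 0 <= K & forall p,
    norm1 (cexp (- q) - \sum_(i < p.+1) (- q) ^+ i / (i`!)%:R) <= K / 2 ^+ p.*2.+1.
Proof.
have [c cq] : exists c, c ^+ 2 = q by exists (sqrtc q); exact: sqr_sqrtc.
have [|K K0 HK] := @hermite_function_series R 0 (1 + norm1 c).
  by rewrite lerDl norm1_ge0.
exists K => // p; have := HK p.*2.+1 c; rewrite lerDr ler01 => /(_ isT).
rewrite {1}/hermite_function hermite0 mulr1 cq.
have coef i : hermite_function i.*2 (0 : R[i]) / (i.*2`!)%:R = (-1) ^+ i / (i`!)%:R.
  have hk : kummer_coef 1 (fun m => hermite_function m (0 : R[i])).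
    split=> [|m]; first exact: (hermite_function_odd_at0 R 0).
    by rewrite hermite_functionSS_at0.
  have := kummer_coef_even (d := 0) i hk.
  rewrite /sphere_coef /= rmorph_nat {2}/hermite_function hermite0 mulr1.
  rewrite expr0n /= oppr0 (cexp_real 0 : cexp 0 = _) expR0 mul1r mulrC.
  by apply: mulfI; rewrite pnatr_eq0.
rewrite (@sum_even _
  (fun m => (- c) ^+ m / (m`!)%:R * hermite_function (0 + m) 0)) => [|j oj].
  congr (norm1 (_ - _) <= _); apply: eq_bigr => i _.
  rewrite -mulrA [_^-1 * _]mulrC add0n coef.
  rewrite -mul2n exprM sqrrN cq [(- q) ^+ i]exprNn; ring.
by rewrite -[j]odd_double_half oj hermite_function_odd_at0 mulr0.
Qed.

Lemma norm1_dot_unit n (z : 'rV[R[i]]_n) (w : 'rV[R]_n) : dot w w = 1 ->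
  norm1 (dot z (toC w)) <= 1 + \sum_(i < n) norm1 (z 0 i).
Proof.
move=> w1; apply: (@le_trans _ _ (\sum_(i < n) norm1 (z 0 i))); last by rewrite lerDr.
apply: le_trans (norm1_sum _ _ _) _; apply: ler_sum => i _.
rewrite mxE mulrC norm1Z ler_piMl ?norm1_ge0//.
rewrite -(@ler_pXn2r _ 2) ?nnegrE// expr1n real_normK ?num_real// -w1.
rewrite /dot (bigD1 i)//= expr2 lerDl sumr_ge0// => j _.
by rewrite -expr2 sqr_ge0.
Qed.

(** Integration over the sphere turns [F (z w)] into a multiple of the Gaussian
    as soon as the Taylor coefficients of [F] satisfy the Kummer recursion
    attached to the dimension. *)
Lemma sphere_mean d (F : R[i] -> R[i]) f (z : 'rV[R[i]]_d.+1) :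
  entire_with F f -> kummer_coef d.+1 f ->
  sphere_integral_rec (fun w => F (dot z (toC w))) =
  f 0 * (sphere_area R d)%:C * cexp (- dot z z).
Proof.
move=> Ff fk; set M := 1 + \sum_(i < d.+1) norm1 (z 0 i).
have [|K K0 HK] := Ff M; first by rewrite lerDl sumr_ge0// => i _; exact: norm1_ge0.
pose S N (w : 'rV[R]_d.+1) := \sum_(m < N) (- dot z (toC w)) ^+ m / (m`!)%:R * f m.
have SE N : S N = (fun w =>
    \sum_(m < N) ((-1) ^+ m / (m`!)%:R * f m) * dot z (toC w) ^+ m).
  by apply/funext => w; apply: eq_bigr => m _; rewrite [(- dot _ _) ^+ _]exprNn; ring.
have SI N : sphere_continuous (S N) /\ sphere_integral_rec (S N) =
    \sum_(m < N) ((-1) ^+ m / (m`!)%:R * f m) * sphere_moment m z.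
  rewrite SE; have [c ->] := sphere_sum N (fun m => (-1) ^+ m / (m`!)%:R * f m)
    (fun m => (sphere_power m z).1).
  by split=> //; apply: eq_bigr => m _; rewrite (sphere_power m z).2.
have FS N w : dot w w = 1 -> norm1 (F (dot z (toC w)) - S N w) <= K / 2 ^+ N.
  by move=> w1; exact/HK/norm1_dot_unit.
have Fc : sphere_continuous (fun w => F (dot z (toC w))).
  apply: sphere_uniform_limit => eps eps0.
  have [N KN] := geometric_le K eps0; exists (S N); first exact: (SI N).1.
  by move=> w w1; exact: le_trans (FS N w w1) KN.
have IF N : norm1 (sphere_integral_rec (fun w => F (dot z (toC w))) -
      sphere_integral_rec (S N)) <= sphere_bound R d * (K / 2 ^+ N).
  have [Dc] := sphere_lin (-1) (SI N).1 Fc; rewrite mulN1r addrC => <-.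
  apply: sphere_le => // w w1; rewrite mulN1r addrC; exact: FS.
have [K' K'0 HK'] := entire_with_gauss (dot z z).
apply/eqP; rewrite -subr_eq0; apply/eqP/norm1_eq0.
set c := f 0 * _.
apply: (@le0_geometric _ (sphere_bound R d * K + norm1 c * K')) => p.
have := IF p.*2.+1; rewrite (SI _).2 kummer_partial_sum// -/c => I1.
set T := \sum_(i < p.+1) _ in I1.
rewrite (_ : _ - _ = (sphere_integral_rec (fun w => F (dot z (toC w))) - c * T)
  - c * (cexp (- dot z z) - T)); last by ring.
apply: le_trans (norm1D _ _) _; rewrite norm1N.
apply: le_trans (lerD I1 (le_trans (norm1M _ _) (ler_wpM2l (norm1_ge0 _) (HK' p)))) _.
rewrite !mulrA -mulrDl ler_wpM2l//.
  by rewrite addr_ge0// mulr_ge0 ?norm1_ge0// ltW// sphere_bound_gt0.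
rewrite lef_pV2 ?posrE ?exprn_gt0// -!natrX ler_nat leq_exp2l//.
by rewrite -addnn; lia.
Qed.

End SphereMeans.

(** * The normalizing constant *)

Section Normalization.
Variable R : realType.
Implicit Types n d : nat.

Lemma sphere_areaSS d :
  sphere_area R d.+2 = 2 * pi / d.+1%:R * sphere_area R d.
Proof. by rewrite /= -mulrA wallis_consecutive mulrC. Qed.

(** Together with [sphere_areaSS] and [top_coef] this shows that both sides of
    [normalization] are multiplied by [2 `^ (1 / 2)] when the dimension grows
    by two. *)
Lemma A_constSS n : A_const R n.+2 = - A_const R n / (2 `^ (3 / 2) * pi).
Proof.
have p0 : pi != 0 :> R by rewrite gt_eqF// pi_gt0.
have t0 (r : R) : 2 `^ r != 0 :> R by rewrite gt_eqF// powR_gt0.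
have u0 (r : R) : pi `^ r != 0 :> R by rewrite gt_eqF// powR_gt0// pi_gt0.
have dE (k : R) : 3 * (k + 1) / 2 = 3 * k / 2 + 3 / 2 by field.
rewrite /A_const /= negbK -[((n./2).+1)%:R]natr1 dE exprS mulN1r.
case: ifP => _.
  rewrite addrAC powRD; last by rewrite pnatr_eq0 implybT.
  rewrite exprS; move: p0; move: (pi : R) => P p0.
  by field; rewrite p0 !t0 expf_neq0.
rewrite [n./2%:R + 1 + _]addrAC !powRD ?pnatr_eq0 ?p0 ?implybT//.
rewrite powRr1 ?pi_ge0//; move: p0 u0; move: (pi : R) => P p0 u0.
by field; rewrite p0 !t0 !u0.
Qed.

(** The value at the origin of the Hermite function of index [d] when [d] is
    even, and of its Hilbert transform when [d] is odd. *)
Fixpoint top_coef d : R :=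
  match d with
  | 0 => 1
  | 1 => - (2 * Num.sqrt pi)
  | e.+2 => - (2 * e.+1%:R) * top_coef e
  end.

Lemma nat_ind2 (P : nat -> Prop) :
  P 0%N -> P 1%N -> (forall d, P d -> P d.+2) -> forall d, P d.
Proof.
move=> P0 P1 PS d; suff: P d /\ P d.+1 by case.
by elim: d => [|d [Pd PSd]]; split=> //; exact: PS.
Qed.

Lemma normalization d :
  A_const R d.+1 * (top_coef d * sphere_area R d) = 2 `^ (d.+1%:R / 4).
Proof.
have p0 : pi != 0 :> R by rewrite gt_eqF// pi_gt0.
have t0 (r : R) : 2 `^ r != 0 :> R by rewrite gt_eqF// powR_gt0.
have tD (r s : R) : 2 `^ (r + s) = 2 `^ r * 2 `^ s :> R.
  by rewrite powRD// pnatr_eq0 implybT.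
have E4 : 2 `^ (3 / 2) * 2 `^ (2 / 4) = 4 :> R.
  rewrite -tD (_ : 3 / 2 + 2 / 4 = 2%:R); last by field.
  by rewrite powR_mulrn// expr2; ring.
elim/nat_ind2: d => [||d IH].
- rewrite /A_const /= mulr0 mul0r add0r expr0 mulr1 !mul1r.
  have E : 2 `^ (3 / 4) * 2 `^ (4^-1) = 2 :> R.
    by rewrite -tD (_ : 3 / 4 + 4^-1 = 1) ?powRr1//; field.
  by apply: (mulfI (t0 (3 / 4))); rewrite E mulrA mulfV// mul1r.
- rewrite /A_const /= mulr1 expr1 wallis00.
  have u0 : Num.sqrt pi != 0 :> R by rewrite gt_eqF// sqrtr_gt0 pi_gt0.
  have -> : pi `^ (1 + 1 / 2) = pi * Num.sqrt pi :> R.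
    rewrite powRD ?p0 ?implybT// powRr1 ?pi_ge0// mul1r powR12_sqrt ?pi_ge0//.
  apply: (mulfI (t0 (3 / 2))); rewrite E4.
  move: p0 u0; move: (pi : R) (Num.sqrt (pi : R)) => P S p0 u0.
  by field; rewrite p0 u0 t0.
- have n0 : d.+1%:R != 0 :> R by rewrite pnatr_eq0.
  rewrite A_constSS sphere_areaSS [top_coef _]/=.
  transitivity (4 / 2 `^ (3 / 2) * (A_const R d.+1 * (top_coef d * sphere_area R d))).
    move: n0 p0; move: d.+1%:R (pi : R) => x P x0 p0.
    by field; rewrite x0 p0 t0.
  rewrite IH (_ : d.+3%:R / 4 = d.+1%:R / 4 + 2 / 4); last first.
    by rewrite -!natr1; field.
  have E5 : 4 / 2 `^ (3 / 2) = 2 `^ (2 / 4) :> R.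
    by apply: (mulfI (t0 (3 / 2))); rewrite E4 mulrC divfK.
  by rewrite tD mulrC E5.
Qed.

Lemma hermite_function_at0 d : ~~ odd d ->
  hermite_function d 0 = (top_coef d)%:C.
Proof.
elim/nat_ind2: d => // [|d IH] /=.
  by rewrite /hermite_function hermite0 mulr1 expr0n oppr0 (cexp_real 0) expR0.
rewrite negbK => /IH; rewrite hermite_functionSS_at0 => ->.
by rewrite rmorphM rmorphN rmorphM !rmorph_nat.
Qed.

Lemma hermite_moment_top d : odd d -> - hermite_moment R d = (top_coef d)%:C.
Proof.
elim/nat_ind2: d => // [_|d IH] /=; first by rewrite hermite_moment1 -rmorphN.
rewrite negbK => /IH; rewrite hermite_momentSS -mulrN => ->.
by rewrite rmorphM rmorphN rmorphM !rmorph_nat.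
Qed.

Lemma sphere_mean_hermite d (z : 'rV[R[i]]_d.+1) : ~~ odd d ->
  (A_const R d.+1)%:C *
    sphere_integral_rec (fun w => hermite_function d (dot z (toC w))) =
  (2 `^ (d.+1%:R / 4))%:C * cexp (- dot z z).
Proof.
move=> od; rewrite (@sphere_mean _ _ _ (fun m => hermite_function (d + m) 0)).
- rewrite addn0 hermite_function_at0// -normalization !rmorphM /=; ring.
- by move=> M M1; exact: hermite_function_series.
split=> [|m]; last by rewrite !addnS hermite_functionSS_at0 addSn.
by rewrite addn1 -[d]odd_double_half (negbTE od) hermite_function_odd_at0.
Qed.

Lemma sphere_mean_hilbert d (z : 'rV[R[i]]_d.+1) : odd d ->
  (A_const R d.+1)%:C *
    sphere_integral_rec (fun w => - hermite_hilbert d (dot z (toC w))) =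
  (2 `^ (d.+1%:R / 4))%:C * cexp (- dot z z).
Proof.
move=> od; rewrite (@sphere_mean _ _ (fun c => - hermite_hilbert d c)
  (fun m => - hermite_moment R (d + m))).
- rewrite addn0 hermite_moment_top// -normalization !rmorphM /=; ring.
- move=> M M1; have [K K0 HK] := hermite_hilbert_series d M1.
  exists K => // N c /(HK N); rewrite -norm1N; congr (norm1 _ <= _).
  by rewrite opprD; congr (_ - _); rewrite -sumrN; apply: eq_bigr => m _; ring.
split=> [|m]; last by rewrite !addnS hermite_momentSS addSn; ring.
rewrite addn1 -[d]odd_double_half od add1n -doubleS.
by rewrite hermite_moment_even oppr0.
Qed.

End Normalization.

(** * The Hilbert transform of the kernel and its parity *)

Section HilbertTransform.
Variable R : realType.
Local Notation mu := (@lebesgue_measure R).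

Lemma measurable_far (e t : R) :
  measurable ([set s | e < `|t - s|] : set (measurableTypeR R)).
Proof.
rewrite (_ : [set s | _] = `]-oo, t - e[%classic `|` `]t + e, +oo[%classic).
  by apply: measurableU; exact: measurable_itv.
apply/seteqP; split => s /=; rewrite !in_itv/= andbT lter_normr opprB ltrBrDr ltrBrDr.
  by case/orP => ?; [left|right]; lra.
by case=> ?; apply/orP; [left|right]; lra.
Qed.

Lemma Re_div_real (z : R[i]) (r : R) : Re (z / r%:C) = Re z / r.
Proof. by rewrite -fmorphV mulrC ReZ mulrC. Qed.

Lemma Im_div_real (z : R[i]) (r : R) : Im (z / r%:C) = Im z / r.
Proof. by rewrite -fmorphV mulrC ImZ mulrC. Qed.

Section Scaling.
Variables (C b t : R) (g : R -> R).
Hypotheses (b0 : 0 < b) (gdec : decaying C g).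

Let Rintegral_scaled (e : R) : 0 < e ->
  \int[mu]_(s in [set s | e < `|t - s|]) (g (b * (t - s)) / (t - s)) =
  - \int[mu]_(x in [set x | b * e < `|x|]) (g (- x) / x).
Proof.
move=> e0; have be0 : 0 < b * e by rewrite mulr_gt0.
pose D : set (measurableTypeR R) := [set x | b * e < `|x|].
have mD : measurable D.
  have := measurable_far (b * e) 0; congr measurable.
  by apply/funext => x /=; rewrite sub0r normrN.
have preD : (fun x => b * x + - (b * t)) @^-1` D = [set s | e < `|t - s|].
  apply/funext => s; rewrite /D /= -mulrBr normrM gtr0_norm// ltr_pM2l//.
  by rewrite distrC.
have fi := integrable_far be0 (decaying_opp gdec).
have Eaff := Rintegral_affine (- (b * t)) b0 mD fi; rewrite preD in Eaff.
rewrite -[RHS]mulN1r -(mulfV (lt0r_neq0 b0)) -mulNr -mulrA -Eaff.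
have mE : measurable ([set s | e < `|t - s|] : set (measurableTypeR R)).
  exact: measurable_far.
rewrite -RintegralZl//; last first.
  have := @integrable_transfer R
    (fun x : measurableTypeR R => b * x + - (b * t)) b^-1 _ _ _ D _ mD fi.
  rewrite preD; apply; rewrite ?invr_gt0//.
    by apply: measurable_funD => //; exact: measurable_funM.
  by move=> A mA; exact: lebesgue_measure_affine.
apply: eq_Rintegral => s; rewrite inE /= => es.
have ts0 : t - s != 0 by rewrite -normr_gt0 (lt_trans e0).
have b0' : b != 0 by rewrite gt_eqF.
rewrite (_ : - (b * s - b * t) = b * (t - s)); last by ring.
rewrite (_ : b * s - b * t = - b * (t - s)); last by ring.
by field; rewrite ts0 b0'.
Qed.

(** The kernel [1 / x] is homogeneous, so the scale [b] disappears; the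
    substitution [x = b * (s - t)] reverses both the argument of [g] and the
    sign of the kernel. *)
Lemma scaled_pv_lim :
  \int[mu]_(s in [set s | e < `|t - s|]) (g (b * (t - s)) / (t - s))
    @[e --> 0^'+] --> pv g.
Proof.
have lim_opp : - (\int[mu]_(x in [set x | e < `|x|]) (g (- x) / x))
    @[e --> 0^'+] --> pv g.
  rewrite -[pv g]opprK -(pv_opp gdec); apply: cvgN.
  exact: pv_lim (decaying_opp gdec).
apply/cvgrPdist_le => /= eps eps0.
move/cvgrPdist_le : lim_opp => /(_ _ eps0) [d /= d0 Hd].
near=> e.
have e0 : 0 < e by near: e; exact: nbhs_right_gt.
rewrite Rintegral_scaled//; apply: Hd; last by rewrite mulr_gt0.
rewrite /= sub0r normrN gtr0_norm ?mulr_gt0// mulrC -ltr_pdivlMr//.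
by near: e; apply: nbhs_right_lt; rewrite divr_gt0.
Unshelve. all: by end_near. Qed.

End Scaling.

Lemma B_kernelE n (h : R) (z : 'rV[R[i]]_n) (w : 'rV[R]_n) (t : R) : 0 < h ->
  B_kernel h z w t =
  hermite_function n.-1 ((Num.sqrt (pi / h))%:C * (dot z (toC w) - t%:C)).
Proof.
move=> h0; rewrite /B_kernel /hermite_function exprMn -rmorphXn /= sqr_sqrtr.
  by rewrite -mulNr -rmorphN.
by rewrite divr_ge0 ?pi_ge0// ltW.
Qed.

Lemma hilbert_B_kernel n (h : R) (z : 'rV[R[i]]_n) (w : 'rV[R]_n) (t : R) :
  0 < h -> hilbert (B_kernel h z) w t =
  hermite_hilbert n.-1 ((Num.sqrt (pi / h))%:C * (dot z (toC w) - t%:C)).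
Proof.
move=> h0; set b := Num.sqrt (pi / h); set c := b%:C * _.
have b0 : 0 < b by rewrite sqrtr_gt0 divr_gt0 ?pi_gt0.
have [C [Cr Ci]] := hermite_function_cdecaying n.-1 c.
have BE s : B_kernel h z w s = hermite_function n.-1 ((b * (t - s))%:C + c).
  rewrite B_kernelE// /c rmorphM rmorphB /=; congr hermite_function; ring.
have BF : B_kernel h z w = fun s => hermite_function n.-1 ((b * (t - s))%:C + c).
  exact/funext.
rewrite /hilbert /hilbert_trunc /cintegral BF /hermite_hilbert /cpv /=.
congr (_ +i* _); apply: cvg_lim => //.
  under [X in X @ _ --> _]eq_fun do under eq_Rintegral do rewrite Re_div_real.
  exact: (scaled_pv_lim t b0 Cr).
under [X in X @ _ --> _]eq_fun do under eq_Rintegral do rewrite Im_div_real.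
exact: (scaled_pv_lim t b0 Ci).
Qed.

(** Replacing [(w, t)] by [(- w, - t)] reflects the variable of integration;
    the truncations are symmetric and the kernel is odd. *)
Section Reflection.
Variables (n : nat) (U : 'rV[R]_n -> R -> R[i]) (w : 'rV[R]_n) (t : R).
Hypotheses (Uw : forall s, U (- w) s = U w (- s)) (Uex : hilbert_exists U w t).

Let D (e : R) : set (measurableTypeR R) := [set s | e < `|t - s|].

Let far_opp (e : R) : [set s | e < `|- t - s|] = -%R @^-1` D e.
Proof.
by apply/funext => s; rewrite /D /= opprK -opprD normrN.
Qed.

Let integrand_opp s : U (- w) s / (- t - s)%:C = - (U w (- s) / (t - - s)%:C).
Proof. by rewrite Uw -opprD rmorphN invrN mulrN opprK. Qed.

Let integrable_reflected (e : R) : 0 < e ->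
  cintegrable [set s | e < `|- t - s|] (fun s => U (- w) s / (- t - s)%:C).
Proof.
case: Uex => ex _ _ /ex [exr exi]; rewrite far_opp.
have mD : measurable (D e) by exact: measurable_far.
have mND : measurable (-%R @^-1` D e : set (measurableTypeR R)).
  by rewrite -far_opp; exact: measurable_far.
split.
  have := integrableN (integrable_opp mD exr); apply: eq_integrable => // s _.
  by rewrite integrand_opp ReN.
have := integrableN (integrable_opp mD exi); apply: eq_integrable => // s _.
by rewrite integrand_opp ImN.
Qed.

Let trunc_reflected (e : R) : 0 < e ->
  hilbert_trunc U (- w) (- t) e = - hilbert_trunc U w t e.
Proof.
case: Uex => ex _ _ /ex [exr exi]; rewrite /hilbert_trunc far_opp /cintegral.
have mD : measurable (D e) by exact: measurable_far.
have mND : measurable (-%R @^-1` D e : set (measurableTypeR R)).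
  by rewrite -far_opp; exact: measurable_far.
have half (P : R[i] -> R) : (forall z, P (- z) = - P z) ->
    mu.-integrable (D e) (fun s => (P (U w s / (t - s)%:C))%:E) ->
    \int[mu]_(s in -%R @^-1` D e) P (U (- w) s / (- t - s)%:C) =
    - \int[mu]_(s in D e) P (U w s / (t - s)%:C).
  move=> PN Pi; rewrite -(Rintegral_opp mD Pi) -[RHS]mulN1r.
  rewrite -RintegralZl//; last exact: integrable_opp mD Pi.
  by apply: eq_Rintegral => s _; rewrite integrand_opp PN mulN1r.
by apply: complexP => /=; apply: half; [exact: ReN|exact: exr|exact: ImN|exact: exi].
Qed.

Lemma hilbert_reflected :
  hilbert_exists U (- w) (- t) /\ hilbert U (- w) (- t) = - hilbert U w t.
Proof.
case: (Uex) => ex cr ci.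
have half (P : R[i] -> R) : (forall z, P (- z) = - P z) ->
    cvg (P (hilbert_trunc U w t e) @[e --> (0 : R)^'+]) ->
    P (hilbert_trunc U (- w) (- t) e) @[e --> (0 : R)^'+] -->
      - lim (P (hilbert_trunc U w t e) @[e --> (0 : R)^'+]).
  move=> PN Pc; apply: cvg_trans (cvgN Pc).
  apply: near_eq_cvg; near=> e.
  by rewrite trunc_reflected ?PN//; near: e; exact: nbhs_right_gt.
have hr := half _ (@ReN R) cr; have hi := half _ (@ImN R) ci.
split.
  by split; [exact: integrable_reflected|exact: cvgP hr|exact: cvgP hi].
by apply: complexP; [exact: cvg_lim hr|exact: cvg_lim hi].
Unshelve. all: by end_near. Qed.

End Reflection.

End HilbertTransform.

(** * Smoothness of the Gaussian *)

Section SmoothGaussian.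
Variables (R : realType) (n : nat).
Implicit Types f g : 'rV[R]_n -> R[i].

(** A class of functions stable under partial derivatives that contains the
    Gaussian: membership gives all derivatives at once. *)
Inductive exp_poly : ('rV[R]_n -> R[i]) -> Prop :=
  | exp_poly_cst a : exp_poly (fun=> a)
  | exp_poly_coord j : exp_poly (fun y => (y 0 j)%:C)
  | exp_poly_add f g : exp_poly f -> exp_poly g -> exp_poly (fun y => f y + g y)
  | exp_poly_mul f g : exp_poly f -> exp_poly g -> exp_poly (fun y => f y * g y)
  | exp_poly_exp f : exp_poly f -> exp_poly (fun y => cexp (f y)).

Lemma exp_poly_differentiable f : exp_poly f -> forall x,
  differentiable (fun y => Re (f y) : R) x /\
  differentiable (fun y => Im (f y) : R) x.
Proof.
elim=> {f} [a|j|f g _ IHf _ IHg|f g _ IHf _ IHg|f _ IHf] x.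
- by split; exact: differentiable_cst.
- by split; [exact: differentiable_coord|exact: differentiable_cst].
- have [fr fi] := IHf x; have [gr gi] := IHg x; split.
    by under eq_fun do rewrite ReD; exact: differentiableD.
  by under eq_fun do rewrite ImD; exact: differentiableD.
- have [fr fi] := IHf x; have [gr gi] := IHg x; split.
    by under eq_fun do rewrite ReM; apply: differentiableB; exact: differentiableM.
  by under eq_fun do rewrite ImM; apply: differentiableD; exact: differentiableM.
- have [fr fi] := IHf x.
  have dd (h : R -> R) (dh r : R) : is_derive r 1 h dh -> differentiable h r.
    by case=> hd _; exact/derivable1_diffP.
  split; apply: differentiableM.
  + exact: differentiable_comp fr (dd _ _ _ (is_derive_expR _)).
  + exact: differentiable_comp fi (dd _ _ _ (is_derive_cos _)).
  + exact: differentiable_comp fr (dd _ _ _ (is_derive_expR _)).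
  + exact: differentiable_comp fi (dd _ _ _ (is_derive_sin _)).
Qed.

Lemma exp_poly_cderive i f : exp_poly f ->
  exists2 df, exp_poly df &
    forall x : 'rV[R]_n, is_cderive x (delta_mx 0 i) f (df x).
Proof.
elim=> {f} [a|j|f g fe [df dfe fd] ge [dg dge gd]
           |f g fe [df dfe fd] ge [dg dge gd]|f fe [df dfe fd]].
- by exists (fun=> 0) => [|x]; [exact: exp_poly_cst|exact: is_cderive_cst].
- exists (fun=> ((delta_mx 0 i : 'rV[R]_n) 0 j)%:C) => [|x]; first exact: exp_poly_cst.
  split => /=; last exact: is_derive_cst.
  have did := @derivable_id R 'rV[R]_n x (delta_mx 0 i).
  have dj := (derivable_mxP (fun y => y) x (delta_mx 0 i)).1 did 0 j.
  have := derive_mx did; rewrite derive_id => /matrixP/(_ 0 j); rewrite [RHS]mxE => ->.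
  exact: derivableP.
- exists (fun y => df y + dg y) => [|x]; first exact: exp_poly_add.
  exact: is_cderiveD.
- exists (fun y => df y * g y + f y * dg y) => [|x].
    by apply: exp_poly_add; exact: exp_poly_mul.
  exact: is_cderiveM.
- exists (fun y => cexp (f y) * df y) => [|x].
    by apply: exp_poly_mul => //; exact: exp_poly_exp.
  exact: is_cderive_cexp.
Qed.

Lemma exp_poly_partial i f : exp_poly f -> exp_poly (partial i f).
Proof.
move=> fe; have [df dfe fd] := exp_poly_cderive i fe.
rewrite (_ : partial i f = df)//; apply/funext => x.
by case: (fd x) => [[_ dr] [_ di]]; apply: complexP; rewrite /= ?dr ?di.
Qed.

Lemma exp_poly_smooth f : exp_poly f -> smooth f.
Proof.
move=> fe s x; apply: exp_poly_differentiable.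
by elim: s => [|i s IH] //=; exact: exp_poly_partial.
Qed.

Lemma exp_poly_sum m (F : 'I_m -> 'rV[R]_n -> R[i]) :
  (forall j, exp_poly (F j)) -> exp_poly (fun y => \sum_(j < m) F j y).
Proof.
elim: m F => [|m IH] F Fe.
  rewrite (_ : (fun _ => _) = fun=> 0); first exact: exp_poly_cst.
  by apply/funext => y; rewrite big_ord0.
rewrite (_ : (fun _ => _) =
  fun y => \sum_(j < m) F (widen_ord (leqnSn m) j) y + F ord_max y).
  by apply: exp_poly_add => //; apply: IH.
by apply/funext => y; rewrite big_ord_recr.
Qed.

Lemma smooth_gauss (k : R[i]) (z : 'rV[R[i]]_n) :
  smooth (fun y => cexp (k * dot (z - toC y) (z - toC y))).
Proof.
apply: exp_poly_smooth; apply: exp_poly_exp.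
apply: exp_poly_mul; first exact: exp_poly_cst.
apply: exp_poly_sum => j.
have e : exp_poly (fun y => (z - toC y) 0 j).
  rewrite (_ : (fun y => _) = fun y : 'rV[R]_n => z 0 j + -1 * (y 0 j)%:C).
    apply: exp_poly_add; first exact: exp_poly_cst.
    by apply: exp_poly_mul; [exact: exp_poly_cst|exact: exp_poly_coord].
  by apply/funext => y; rewrite !mxE mulN1r.
exact: exp_poly_mul.
Qed.

Lemma distribution_scale (u : ('rV[R]_n -> R[i]) -> R[i]) (a : R[i]) f :
  compact_distribution u -> smooth f -> u (fun x => a * f x) = a * u f.
Proof.
move=> [ulin _] fs.
have s0 : smooth (fun _ : 'rV[R]_n => 0 : R[i]).
  by apply: exp_poly_smooth; exact: exp_poly_cst.
have := ulin 1 _ _ s0 s0; rewrite mul1r addr0.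
move/eqP; rewrite mul1r -subr_eq0 opprD addrA subrr add0r oppr_eq0 => /eqP u0.
have := ulin a _ _ fs s0; rewrite u0 addr0 => <-.
by congr u; apply/funext => x; rewrite addr0.
Qed.

End SmoothGaussian.

(** * The factorization of the Bargmann transform *)

Section Transforms.
Variable R : realType.

Lemma dot_scaled n (b : R) (z : 'rV[R[i]]_n) (y w : 'rV[R]_n) :
  b%:C * (dot z (toC w) - (dot y w)%:C) = dot (b%:C *: (z - toC y)) (toC w).
Proof.
rewrite /dot rmorph_sum -sumrB mulr_sumr; apply: eq_bigr => i _.
by rewrite !mxE rmorphM /=; ring.
Qed.

Lemma dot_scaled_sqr n (b : R) (z : 'rV[R[i]]_n) :
  dot (b%:C *: z) (b%:C *: z) = (b ^+ 2)%:C * dot z z.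
Proof.
rewrite /dot mulr_sumr; apply: eq_bigr => i _.
by rewrite !mxE rmorphXn /=; ring.
Qed.

(** Both sides pair [u] with a test function, so an identity between the test
    functions at each point [y] suffices: it is the mean value identity at
    [zeta = sqrt (pi / h) (z - y)].  The function [K] stands for the kernel of
    [B_transform], or for minus its Hilbert transform. *)
Lemma bargmann_of_sphere_mean n (h : R) (F : R[i] -> R[i])
    (K : 'rV[R]_n -> R -> R[i]) (u : ('rV[R]_n -> R[i]) -> R[i]) (z : 'rV[R[i]]_n) :
  0 < h -> compact_distribution u ->
  (forall zeta : 'rV[R[i]]_n,
     (A_const R n)%:C * sphere_integral (fun w => F (dot zeta (toC w))) =
     (2 `^ (n%:R / 4))%:C * cexp (- dot zeta zeta)) ->
  (forall w t, K w t = F ((Num.sqrt (pi / h))%:C * (dot z (toC w) - t%:C))) ->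
  bargmann h u z = (A_const R n * h `^ (- (3 * n%:R / 4)))%:C * u (dual_radon K).
Proof.
move=> h0 ud FE KE; set b := Num.sqrt (pi / h) in KE.
have b2 : b ^+ 2 = pi / h by rewrite sqr_sqrtr// divr_ge0 ?pi_ge0// ltW.
have A0 : A_const R n != 0.
  by rewrite /A_const; case: ifP => _;
    rewrite mulf_neq0 ?invr_neq0 ?mulf_neq0 ?expf_neq0 ?oppr_eq0 ?oner_eq0//
      gt_eqF ?powR_gt0 ?pi_gt0.
have A0' : (A_const R n)%:C != 0 by rewrite fmorph_eq0.
pose G (y : 'rV[R]_n) := cexp (- (pi / h)%:C * dot (z - toC y) (z - toC y)).
have -> : dual_radon K = fun y => (2 `^ (n%:R / 4))%:C / (A_const R n)%:C * G y.
  apply/funext => y; apply: (mulfI A0').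
  rewrite /dual_radon; under eq_fun do rewrite KE dot_scaled.
  by rewrite FE dot_scaled_sqr b2 mulrA (mulrC (A_const R n)%:C) divfK// /G mulNr.
rewrite distribution_scale//; last exact: smooth_gauss.
rewrite /bargmann -/G !rmorphM /= mulrA; congr (_ * _).
move: A0'; move: (A_const R n)%:C (2 `^ _)%:C (h `^ _)%:C => A a b' A0'.
by field.
Qed.

End Transforms.

Theorem theorem1 (R : realType) (n : nat) (h : R) (hn : (2 <= n)%N)
    (hh : 0 < h) :
  (forall u : ('rV[R]_n -> R[i]) -> R[i], compact_distribution u ->
     (odd n -> forall z : 'rV[R[i]]_n,
        bargmann h u z = B_transform h (radon u) z) /\
     (~~ odd n -> forall z : 'rV[R[i]]_n,
        bargmann h u z = B_transform h (hilbert_distribution (radon u)) z)) /\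
  (forall U : 'rV[R]_n -> R -> R[i],
     (forall (w : 'rV[R]_n) (t : R), dot w w = 1 -> U (- w) (- t) = U w t) ->
     forall (w : 'rV[R]_n) (t : R), dot w w = 1 -> hilbert_exists U w t ->
       hilbert_exists U (- w) (- t) /\
       hilbert U (- w) (- t) = - hilbert U w t).
Proof.
split=> [u ud|U Ue w t w1 Uex]; last first.
  by apply: hilbert_reflected => // s; rewrite -{1}[s]opprK Ue.
case: n hn u ud => // d hn u ud; split=> od z.
  apply: (@bargmann_of_sphere_mean R d.+1 h (hermite_function d)) => //.
    by move=> zeta; exact: sphere_mean_hermite.
  by move=> w t; exact: B_kernelE.
apply: (@bargmann_of_sphere_mean R d.+1 h (fun c => - hermite_hilbert d c)) => //.
  by move=> zeta; apply: sphere_mean_hilbert; move: od; rewrite /= negbK.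
by move=> w t; rewrite hilbert_B_kernel.
Qed.
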